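(* Let $n\ge1$ and let $G$ be a clique-sum of bipartite graphs and cycles of size $2n+1$ (with at least one such cycle). Let $k$ denote the maximum cardinality of a collection of induced odd cycles in $G$ such that $d(C,C')\ge2$ for any two distinct cycles $C$ and $C'$ in the collection. Then $$\rho(I(G))=\begin{cases}\dfrac{2n+2}{2n+1} & \text{if } k=1,\\[2mm] \dfrac{kn+k}{kn+1} & \text{if } k\ge2.\end{cases}$$
   Context: All graphs are finite and simple, with no isolated vertices. If $G_1,G_2$ are graphs such that $G_1\cap G_2=K_r$ is a complete graph (on $r\ge 1$ vertices), with $G_1\neq K_r$ and $G_2\ne K_r$, then $G_1\cup G_2$ is called the clique-sum of $G_1$ and $G_2$ along $K_r$; a clique-sum of a finite collection of graphs is a graph obtained from them by repeatedly taking clique-sums. For subgraphs $H,H'$ of $G$, $d(H,H')$ is the minimum of $d(u,v)$ over $u\in V(H)$, $v\in V(H')$, where $d(u,v)$ is the length of a shortest path in $G$ from $u$ to $v$. The edge ideal $I(G)$, over a field $\mathbb{K}$, is the ideal of $\mathbb{K}[x : x\in V(G)]$ generated by $\{xy : \{x,y\}\in E(G)\}$. For an ideal $I$ in a Noetherian ring $R$, $I^{(s)}=\bigcap_{P\in\mathrm{Ass}(I)}(I^sR_P\cap R)$ is the $s$-th symbolic power. The resurgence is $\rho(I)=\sup\{s/t : s,t\in\mathbb{N},\ I^{(s)}\not\subset I^t\}$, where $\mathbb{N}$ denotes the positive integers. *)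

(* Defs.v *)
From HB Require Import structures.
From mathcomp Require Import all_boot all_order all_algebra.
From mathcomp Require Import fraction ring_quotient.
From mathcomp Require Import boolp classical_sets reals ereal.
(* The notations of mpoly clash with those of MathComp-Analysis. *)
From mathcomp.multinomials Require mpoly.
Import -(notations) mpoly.

Set Implicit Arguments.
Unset Strict Implicit.
Unset Printing Implicit Defensive.

Import Order.TTheory GRing.Theory Num.Theory.

Section Graphs.
Local Open Scope set_scope.
Variable T : finType.

Definition wf_graph (g : {set T} * {set {set T}}) : bool :=
  [forall e in g.2, (#|e| == 2) && (e \subset g.1)].

(* A graph whose vertices lie in T is the pair of its vertex set and of its
   set of edges; all the pieces of a clique-sum are subgraphs of the result,
   so that they can be taken with vertices in a common T. *)
Definition sgraph := {g : {set T} * {set {set T}} | wf_graph g}.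

Implicit Types (G H : sgraph) (S : {set T}).

Definition vset G : {set T} := (val G).1.
Definition eset G : {set {set T}} := (val G).2.
Definition adj G : rel T := fun x y => [set x; y] \in eset G.

Lemma wf_cap G H : wf_graph (vset G :&: vset H, eset G :&: eset H).
Proof.
apply/forall_inP => e /finset.setIP[eG eH].
have /andP[-> /= sG] := forall_inP (valP G) e eG.
by have /andP[_ sH] := forall_inP (valP H) e eH; rewrite finset.subsetI sG.
Qed.

Lemma wf_cup G H : wf_graph (vset G :|: vset H, eset G :|: eset H).
Proof.
apply/forall_inP => e /finset.setUP[eG | eH].
  have /andP[-> /= sG] := forall_inP (valP G) e eG.
  exact: fintype.subset_trans sG (finset.subsetUl _ _).
have /andP[-> /= sH] := forall_inP (valP H) e eH.
exact: fintype.subset_trans sH (finset.subsetUr _ _).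
Qed.

Lemma wf_induced G S : wf_graph (vset G :&: S, [set e in eset G | e \subset S]).
Proof.
apply/forall_inP => e; rewrite inE => /andP[eG sS].
by have /andP[-> /= sG] := forall_inP (valP G) e eG; rewrite finset.subsetI sG.
Qed.

Definition gcap G H : sgraph := Sub _ (wf_cap G H).
Definition gcup G H : sgraph := Sub _ (wf_cup G H).
Definition induced G S : sgraph := Sub _ (wf_induced G S).

Definition no_isolated G : Prop :=
  forall x, x \in vset G -> exists y, adj G x y.

Definition complete G : Prop :=
  forall x y, x \in vset G -> y \in vset G -> x != y -> adj G x y.

Definition bipartite G : Prop :=
  exists A B : {set T},
    [/\ vset G = A :|: B, [disjoint A & B] &
        forall e, e \in eset G ->
          exists x y, [/\ x \in A, y \in B & e = [set x; y]]].

Definition is_cycle (m : nat) G : Prop :=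
  exists c : seq T,
    [/\ 3 <= m, size c = m, uniq c, vset G = [set x in c] &
        eset G = [set [set x; next c x] | x in c]].

Definition is_clique_sum G1 G2 G : Prop :=
  [/\ 0 < #|vset (gcap G1 G2)|, complete (gcap G1 G2),
      G1 != gcap G1 G2, G2 != gcap G1 G2 & G = gcup G1 G2].

Inductive clique_sum_of : seq sgraph -> sgraph -> Prop :=
| CliqueSum1 G : clique_sum_of [:: G] G
| CliqueSum2 s1 s2 G1 G2 G :
    clique_sum_of s1 G1 -> clique_sum_of s2 G2 -> is_clique_sum G1 G2 G ->
    clique_sum_of (s1 ++ s2) G.

End Graphs.

Section Packing.
Local Open Scope classical_set_scope.
Local Open Scope ereal_scope.
Variables (R : realType) (T : finType) (G : sgraph T).

(* The distance is +oo when there is no path. *)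
Definition gdist (u v : T) : \bar R :=
  ereal_inf [set d | exists p : seq T,
    [/\ path (adj G) u p, uniq (u :: p), last u p = v & d = (size p)%:R%:E]].

Definition gdist_sub (C D : {set T}) : \bar R :=
  ereal_inf [set d | exists u v : T, [/\ u \in C, v \in D & d = gdist u v]].

(* An induced subgraph is represented by its vertex set. *)
Definition induced_odd_cycle (C : {set T}) : Prop :=
  C \subset vset G /\ exists2 m : nat, odd m & is_cycle m (induced G C).

Definition odd_cycle_packing (F : {set {set T}}) : Prop :=
  (forall C : {set T}, C \in F -> induced_odd_cycle C) /\
  (forall C D : {set T}, C \in F -> D \in F -> C != D ->
     2%:R%:E <= gdist_sub C D).

Definition packing_number : nat :=
  \max_(F : {set {set T}} | `[< odd_cycle_packing F >]) #|F|.

End Packing.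

Section Ideals.
Local Open Scope classical_set_scope.
Local Open Scope ring_scope.
Variable A : idomainType.
Implicit Types (I J P S : set A).

Definition ideal_gen S : set A :=
  [set x | exists2 s : seq (A * A), (forall q, q \in s -> S q.2) &
             x = \sum_(q <- s) q.1 * q.2].

Definition ideal_pow I (t : nat) : set A :=
  ideal_gen [set x | exists2 f : 'I_t -> A, (forall i, I (f i)) &
                       x = \prod_(i < t) f i].

Definition prime_ideal P : Prop :=
  idealr_closed [in P] /\ prime_idealr_closed [in P].

(* Associated primes of the module A / I. *)
Definition Ass I : set (set A) :=
  [set P | prime_ideal P /\ exists f : A, P = [set g | I (g * f)]].

(* A being a domain, A_P is realized inside its field of fractions. *)
Definition localization P : set {fraction A} :=
  [set x | exists a b : A, ~ P b /\
             x = FracField.tofrac a / FracField.tofrac b].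

(* J A_P *)
Definition extension P J : set {fraction A} :=
  [set x | exists2 s : seq ({fraction A} * A),
             (forall q, q \in s -> localization P q.1 /\ J q.2) &
             x = \sum_(q <- s) q.1 * FracField.tofrac q.2].

Definition symbolic_pow I (m : nat) : set A :=
  \bigcap_(P in Ass I)
    [set x | extension P (ideal_pow I m) (FracField.tofrac x)].

Definition resurgence (R : realType) I : \bar R :=
  ereal_sup [set r | exists m t : nat,
    [/\ (0 < m)%N, (0 < t)%N, ~ (symbolic_pow I m `<=` ideal_pow I t) &
        r = (m%:R / t%:R)%:E]].

End Ideals.

Section EdgeIdeal.
Local Open Scope classical_set_scope.
Local Open Scope ring_scope.
Variables (K : fieldType) (T : finType) (G : sgraph T).

(* The polynomial ring has one variable per vertex of G, the variable of
   index i being that of the vertex [enum_val i]. *)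
Definition vertex_ring : idomainType := mpoly #|vset G| K.

Definition vertex_var (i : 'I_#|vset G|) : vertex_ring :=
  mpolyX K (mnm1 i).

Definition edge_ideal : set vertex_ring :=
  ideal_gen [set x | exists i j : 'I_#|vset G|,
    adj G (enum_val i) (enum_val j) /\ x = vertex_var i * vertex_var j].

End EdgeIdeal.

Arguments edge_ideal K [T] G _.

(* Main.v *)
Require Import Defs.
From mathcomp Require Import boolp classical_sets.
From mathcomp Require Import all_boot all_order all_algebra.
From mathcomp Require Import reals ereal fraction.
From mathcomp.multinomials Require mpoly.
From mathcomp Require Import zify ring lra.

(** For a weight [a] on the vertices of G, let tau be the least weight of a
    vertex cover and nu the largest number of edges, with repetitions, whose
    total load stays below [a].  The monomial x^a lies in the symbolic power of
    order s exactly when s <= tau, and in the ordinary power of order t exactly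
    when t <= nu; both kinds of powers are monomial ideals.  The resurgence is
    therefore the supremum of tau / (nu + 1) over all weights, and with
    K = max(k, 2) both cases of the formula read K(n+1) / (Kn+1).

    Upper bound.  In a clique-sum of bipartite graphs and (2n+1)-cycles, every
    weight dominates a family of e edges and M cycles such that
    tau <= e + (n+1)M ([packable]).  This integral min-max relation holds for
    bipartite graphs ([packable_bipartite]) and odd cycles ([packable_cycle]),
    and splitting the weights on the common clique carries it over to
    clique-sums ([packable_clique_sum]).  A cycle alone contains n disjoint
    edges, but two cycles that coincide, meet or are joined by an edge carry
    2n+1 edges together.  Pairing such cycles as long as possible
    ([greedy_pairing]) gives p pairs and leaves r <= k cycles, so that
    nu >= e + nM + p with M = 2p + r <= K(p+1); this is the required inequality
    ([near_perfect_matching]).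

    Lower bound.  The induced odd cycles of G are its (2n+1)-cycle pieces, since
    an induced cycle cannot cross a clique ([induced_cycle_in_piece]).  For a
    packing of k of them, the sum of the indicators has tau >= k(n+1) and
    nu <= kn, hence a ratio of at least the bound when k >= 2.  For k = 1,
    odd multiples of the indicator of a single cycle give ratios that tend to
    the bound. *)

Set Implicit Arguments.
Unset Strict Implicit.
Unset Printing Implicit Defensive.

Import Order.TTheory GRing.Theory Num.Theory.

(** * Weights, packings of edges and vertex covers *)

Definition weight (V : finType) (S : {set V}) (a : V -> nat) : nat :=
  \sum_(v in S) a v.

Definition load (V : eqType) (s : seq (V * V)) (v : V) : nat :=
  \sum_(e <- s) ((e.1 == v) + (e.2 == v)).

(** With [r] the adjacency relation of a graph, this says that the monomial with
    exponents [a] is divisible by a product of [t] edges. *)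
Definition packs (V : eqType) (r : rel V) (a : V -> nat) (t : nat) : Prop :=
  exists s : seq (V * V),
    [/\ size s = t, all (fun e => r e.1 e.2) s & forall v, load s v <= a v].

Definition cover (V : finType) (r : rel V) (C : {set V}) : bool :=
  [forall x, forall y, r x y ==> (x \in C) || (y \in C)].

Lemma coverP (V : finType) (r : rel V) (C : {set V}) :
  reflect (forall x y, r x y -> (x \in C) || (y \in C)) (cover r C).
Proof.
apply: (iffP forallP) => [h x y|h x].
  by move/implyP: (forallP (h x) y).
by apply/forallP => y; apply/implyP/h.
Qed.

Lemma packs_leq (V : eqType) (r : rel V) (a : V -> nat) (t t' : nat) :
  t' <= t -> packs r a t -> packs r a t'.
Proof.
move=> le_t [s [st sr sa]]; exists (take t' s); split.
- by rewrite size_takel // st.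
- by apply/allP => e /mem_take; apply: (allP sr).
move=> v; apply: leq_trans (sa v).
by rewrite /load -{2}(cat_take_drop t' s) big_cat leq_addr.
Qed.

(** * Ideals and localizations of a domain *)

Section Ideals.
Variable A : idomainType.
Implicit Types (S I J : set A).
Local Open Scope ring_scope.

Lemma ideal_gen0 S : ideal_gen S 0.
Proof. by exists [::]; rewrite ?big_nil. Qed.

Lemma ideal_genD S x y : ideal_gen S x -> ideal_gen S y -> ideal_gen S (x + y).
Proof.
move=> [s hs ->] [t ht ->]; exists (s ++ t); last by rewrite big_cat.
by move=> q; rewrite mem_cat => /orP[/hs|/ht].
Qed.

Lemma ideal_genMl S c x : ideal_gen S x -> ideal_gen S (c * x).
Proof.
move=> [s hs ->]; exists [seq (c * q.1, q.2) | q <- s].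
  by move=> q /mapP[q' /hs ? ->].
by rewrite big_map mulr_sumr; apply: eq_bigr => q _; rewrite mulrA.
Qed.

Lemma ideal_gen_in S x : S x -> ideal_gen S x.
Proof.
move=> Sx; exists [:: (1, x)]; last by rewrite big_seq1 mul1r.
by move=> q; rewrite inE => /eqP ->.
Qed.

Lemma ideal_gen_min S J :
  J 0 -> (forall x y, J x -> J y -> J (x + y)) -> (forall c x, J x -> J (c * x)) ->
  (forall x, S x -> J x) -> forall x, ideal_gen S x -> J x.
Proof.
move=> J0 JD JM SJ x [s hs ->]; rewrite big_seq.
apply: (big_ind J) => // q /hs /SJ; exact: JM.
Qed.

Lemma ideal_pow0 I x : ideal_pow I 0 x.
Proof.
rewrite -[x]mulr1; apply: ideal_genMl; apply: ideal_gen_in.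
by exists (fun _ => 0); [case|rewrite big_ord0].
Qed.

Lemma ideal_powS I t x y : I x -> ideal_pow I t y -> ideal_pow I t.+1 (x * y).
Proof.
move=> Ix; apply: (ideal_gen_min (J := fun y => ideal_pow I t.+1 (x * y))).
- by rewrite mulr0; apply: ideal_gen0.
- by move=> u v hu hv; rewrite mulrDr; apply: ideal_genD.
- by move=> c u hu; rewrite mulrCA; apply: ideal_genMl.
move=> _ [f fI ->]; apply: ideal_gen_in.
exists (fun i => if unlift ord0 i is Some j then f j else x).
  by move=> i; case: unliftP.
rewrite big_ord_recl unlift_none; congr (_ * _).
by apply: eq_bigr => i _; rewrite liftK.
Qed.

Lemma prime_idealP (P : set A) (a b : A) :
  prime_ideal P -> P (a * b) -> P a \/ P b.
Proof.
move=> [_ pP] Pab; have /orP[] := pP a b (mem_set Pab).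
  by rewrite in_setE; left.
by rewrite in_setE; right.
Qed.

Lemma prime_ideal1 (P : set A) : prime_ideal P -> ~ P 1.
Proof. by move=> [[_ h _] _] /mem_set; rewrite (negbTE h). Qed.

(** Clearing denominators: only finitely many of them occur, and their product
    stays outside of the prime. *)
Lemma extension_ideal_gen (P S : set A) (x : A) :
  prime_ideal P -> extension P (ideal_gen S) (FracField.tofrac x) ->
  exists2 b, ~ P b & ideal_gen S (b * x).
Proof.
move=> pP [s hs xE].
have [b nPb [z Jz zE]] : exists2 b, ~ P b & exists2 z, ideal_gen S z &
   FracField.tofrac b * (\sum_(q <- s) q.1 * FracField.tofrac q.2)
     = FracField.tofrac z.
  elim: s hs {xE} => [|q s IHs] hs.
    exists 1; first exact: prime_ideal1.
    by exists 0; [exact: ideal_gen0|rewrite big_nil mulr0 tofrac0].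
  have [p ps|b nPb [z Jz zE]] := IHs; first by apply: hs; rewrite inE ps orbT.
  have [[c [d [nPd qE]]] Jq] := hs q (mem_head _ _).
  exists (d * b); first by move=> /(prime_idealP pP)[].
  exists (b * c * q.2 + d * z).
    by apply: ideal_genD; apply: ideal_genMl.
  rewrite big_cons mulrDr qE tofracD !tofracM -zE mulrA; congr (_ + _).
    have d0 : FracField.tofrac d != 0.
      rewrite tofrac_eq0; apply/negP => /eqP d0; apply: nPd; rewrite d0.
      by have [[/set_mem]] := pP.
    by field.
  by rewrite ?mulrA.
exists b => //; suff -> : b * x = z by [].
by apply/eqP; rewrite -tofrac_eq tofracM xE zE.
Qed.

Lemma extensionMl (P J : set A) (b x : A) :
  ~ P b -> P 0 -> J (b * x) -> extension P J (FracField.tofrac x).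
Proof.
move=> nPb P0 Jbx; exists [:: (1 / FracField.tofrac b, b * x)].
  move=> q; rewrite inE => /eqP -> /=; split => //.
  by exists 1, b; rewrite tofrac1.
have b0 : FracField.tofrac b != 0.
  by rewrite tofrac_eq0; apply/negP => /eqP b0; apply: nPb; rewrite b0.
by rewrite big_seq1 /= tofracM mulrA -mulrA mul1r mulrA mulVf ?mul1r.
Qed.

(** Primes are produced as kernels of maps into a domain; the map need not be
    given as a bundled morphism, which lets coefficient maps be used. *)
Lemma prime_ideal_ker (B : idomainType) (g : A -> B) (P : set A) :
  (forall x y, g (x + y) = g x + g y) -> (forall x y, g (x * y) = g x * g y) ->
  g 0 = 0 -> g 1 != 0 -> (forall x, P x <-> g x = 0) -> prime_ideal P.
Proof.
move=> gD gM g0 g1 PE.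
have inP x : (x \in P) = (g x == 0) by apply/idP/eqP; rewrite in_setE => /PE.
split; last by move=> u v; rewrite !inP gM mulf_eq0.
split; rewrite ?inP ?g0 //.
by move=> a u v; rewrite !inP gD gM => /eqP -> /eqP ->; rewrite mulr0 addr0.
Qed.

End Ideals.

(** * Powers of an edge ideal *)

Section MonomialIdeals.
Import -(notations) mpoly.
Variables (K : fieldType) (N : nat).
Local Open Scope ring_scope.
Local Notation A := (mpoly N K : idomainType).
Local Notation X m := (mpolyX K m).
Variable r : rel 'I_N.

Definition rel_ideal : set A :=
  ideal_gen [set x | exists i j : 'I_N,
    r i j /\ x = X (mnm1 i) * X (mnm1 j)]%classic.

(** A condition on exponents that survives multiplication by monomials cuts out
    an ideal, so it can be checked on generators. *)
Lemma monomial_ideal_min (U : multinom N -> Prop) (S : set A) (f : A) :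
  (forall m m', U m -> U (mnm_add m' m)) ->
  (forall g, S g -> forall m, m \in msupp g -> U m) ->
  ideal_gen S f -> forall m, m \in msupp f -> U m.
Proof.
move=> Uup SU.
apply: (ideal_gen_min (J := fun f => forall m, m \in msupp f -> U m)) => //.
- by move=> m; rewrite mcoeff_msupp mcoeff0 eqxx.
- by move=> x y hx hy m /msuppD_le; rewrite mem_cat => /orP[/hx|/hy].
by move=> c x hx m /msuppM_le /allpairsPdep[m1 [m2 [_ /hx Um2 ->]]]; apply: Uup.
Qed.

Lemma ideal_of_msupp (S : set A) (f : A) :
  (forall m, m \in msupp f -> ideal_gen S (X m)) -> ideal_gen S f.
Proof.
move=> h; rewrite [f]mpolyE big_seq; apply: (big_ind (ideal_gen S)).
- exact: ideal_gen0.
- by move=> x y; apply: ideal_genD.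
by move=> m /h; rewrite -mul_mpolyC; apply: ideal_genMl.
Qed.

Lemma packs_add (m m' : multinom N) t t' :
  packs r m t -> packs r m' t' -> packs r (mnm_add m m') (t + t')%N.
Proof.
move=> [s [<- sr sm]] [s' [<- sr' sm']]; exists (s ++ s').
split; rewrite ?size_cat ?all_cat ?sr // => v.
by rewrite mnmDE /load big_cat leq_add ?sm ?sm'.
Qed.

Lemma packs0 (a : 'I_N -> nat) : packs r a 0.
Proof. by exists [::]; split => // v; rewrite /load big_nil. Qed.

Lemma packs_edge (m : multinom N) (i j : 'I_N) :
  i != j -> r i j -> (0 < m i)%N -> (0 < m j)%N -> packs r m 1.
Proof.
move=> ij rij mi mj; exists [:: (i, j)]; split => //=; first by rewrite rij.
move=> v; rewrite /load big_seq1 /=.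
case: (eqVneq i v) ij => [<-|_ _]; first by rewrite eq_sym => /negbTE ->.
by case: eqVneq => [<-|].
Qed.

Lemma rel_ideal_msupp (f : A) :
  irreflexive r -> rel_ideal f -> forall m, m \in msupp f -> packs r m 1.
Proof.
move=> rI; apply: monomial_ideal_min.
  by move=> m m' hm; apply: (packs_add (t := 0)) => //; apply: packs0.
move=> _ [i [j [rij ->]]] m; rewrite -mpolyXD => /mem_msuppXP <-.
have ij : i != j by apply: contraTneq rij => ->; rewrite rI.
by apply: (packs_edge ij rij); rewrite mnmDE !mnm1E eqxx ?addn1.
Qed.

(** Powers of an edge ideal are monomial ideals: with [packs_rel_pow], membership
    is decided on the monomials of the support. *)
Lemma rel_pow_msupp t (f : A) :
  irreflexive r -> ideal_pow rel_ideal t f ->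
  forall m, m \in msupp f -> packs r m t.
Proof.
move=> rI; apply: monomial_ideal_min.
  by move=> m m' hm; apply: (packs_add (t := 0)) => //; apply: packs0.
move=> _ [h hI ->]; elim: t h hI => [|t IHt] h hI m.
  by move=> _; apply: packs0.
rewrite big_ord_recl => /msuppM_le /allpairsPdep[m1 [m2 [h1 h2 ->]]].
rewrite -add1n; apply: packs_add; first exact: rel_ideal_msupp h1.
by apply: IHt h2 => i; apply: hI.
Qed.

Lemma packs_rel_pow t (m : multinom N) :
  packs r m t -> ideal_pow rel_ideal t (X m).
Proof.
move=> [s [<-]]; elim: s m => [|e s IHs] m.
  by move=> _ _; apply: ideal_pow0.
move=> /= /andP[re rs] hm.
pose u := mnm_add (mnm1 e.1) (mnm1 e.2).
have le_um : lem u m.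
  apply/mnm_lepP => i; rewrite mnmDE !mnm1E; apply: leq_trans (hm i).
  by rewrite /load big_cons leq_addr.
rewrite -(submK le_um) mpolyXD mulrC; apply: ideal_powS.
  by apply: ideal_gen_in; exists e.1, e.2; rewrite /u mpolyXD.
apply: IHs => // i; have := hm i; rewrite /load big_cons mnmBE mnmDE !mnm1E.
by move=> h; rewrite leq_subRL // (leq_trans (leq_addr _ _) h).
Qed.

End MonomialIdeals.

(** * Symbolic powers of an edge ideal *)

(** Over a domain, a factor with nonzero constant term does not raise the order
    of vanishing at the origin. *)
Lemma coef_low_cancel (B : idomainType) (p q : {poly B}) d : (p`_0 != 0)%R ->
  (forall j, (j < d)%N -> (p * q)`_j = 0)%R ->
  (forall j, (j < d)%N -> q`_j = 0)%R.
Proof.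
move=> p0 h; elim/ltn_ind => j IHj jd.
have := h j jd; rewrite coefM big_ord_recl /= subn0 big1 => [|i _].
  by rewrite addr0 => /eqP; rewrite mulf_eq0 (negbTE p0) => /eqP.
have lt_ij : j - bump 0 i < j.
  by rewrite /bump ltn_subrL /= (leq_ltn_trans _ (ltn_ord i)).
by rewrite (IHj _ lt_ij (ltn_trans lt_ij jd)) mulr0.
Qed.

Section SymbolicPowers.
Import -(notations) mpoly.
Variables (K : fieldType) (N : nat).
Local Open Scope ring_scope.
Local Notation A := (mpoly N K : idomainType).
Local Notation X m := (mpolyX K m).
Implicit Types (C : {set 'I_N}) (m : multinom N) (f b : A).

(** Multiplying the variables of [C] by a new variable records the degree in
    [C]: the order of vanishing of [grade C f] is the least [C]-degree of a
    monomial of [f].  This is the valuation attached to the prime generated by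
    the variables of [C]. *)
Definition grade C : A -> {poly A} :=
  mmap (polyC \o @mpolyC N K)
    (fun i => (X (mnm1 i))%:P * (if i \in C then 'X else 1)).

Lemma gradeX C m :
  mmap1 (fun i => (X (mnm1 i) : A)%:P * (if i \in C then 'X else 1)) m =
  (X m : A)%:P * 'X^(weight C m).
Proof.
rewrite /mmap1 (eq_bigr (fun i => ((X (mnm1 i) : A) ^+ m i)%:P *
   (if i \in C then 'X^(m i) else 1))); last first.
  move=> i _; rewrite exprMn polyC_exp; congr (_ * _).
  by case: ifP => // _; rewrite expr1n.
rewrite big_split /= -rmorph_prod /= -mpolyXE_id; congr (_ * _).
by rewrite -big_mkcond /= prodrXr.
Qed.

Lemma coef_grade C f m j :
  mcoeff m (grade C f)`_j = if weight C m == j then mcoeff m f else 0.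
Proof.
rewrite /grade /mmap coef_sum raddf_sum /=.
rewrite (eq_bigr
  (fun i => (mcoeff i f * (i == m)%:R) * (j == weight C i)%:R)); last first.
  move=> i _; rewrite gradeX /= !coefCM coefXn.
  rewrite mul_mpolyC mcoeffZ -mulrA; congr (_ * _).
  by case: eqP => _; rewrite ?mulr1 ?mulr0 ?mcoeff0 ?mcoeffX ?mulr1.
have [mf|mf] := boolP (m \in msupp f); last first.
  rewrite big_seq big1 => [|i mi]; first by rewrite (memN_msupp_eq0 mf); case: ifP.
  by case: eqP mi mf => [->->|_ _ _]//; rewrite !mulr0 mul0r.
rewrite (bigD1_seq m) //= ?msupp_uniq // eqxx mulr1 big1.
  by rewrite addr0 eq_sym; case: ifP; rewrite ?mulr1 ?mulr0.
by move=> i /negbTE ->; rewrite mulr0 mul0r.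
Qed.

Lemma gradeM C f b : grade C (f * b) = grade C f * grade C b.
Proof.
rewrite /grade.
have -> : mmap (polyC \o @mpolyC N K) = mmap (polyC \o @mpolyC N K :
   {rmorphism K -> {poly A}}) by [].
exact: rmorphM.
Qed.

Lemma grade0M C f b : (grade C (f * b))`_0 = (grade C f)`_0 * (grade C b)`_0.
Proof. by rewrite gradeM coef0M. Qed.

Lemma grade0D C f b : (grade C (f + b))`_0 = (grade C f)`_0 + (grade C b)`_0.
Proof. by rewrite /grade mmapD coefD. Qed.

Lemma grade_low C f d :
  (forall m, m \in msupp f -> (d <= weight C m)%N) <->
  (forall j, (j < d)%N -> (grade C f)`_j = 0).
Proof.
split=> [h j jd|h m mf].
  apply/mpolyP => m; rewrite coef_grade mcoeff0; case: eqP => // dm.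
  by apply/eqP; rewrite mcoeff_eq0; apply/negP => /h; rewrite dm leqNgt jd.
rewrite leqNgt; apply/negP => /h /(congr1 (mcoeff m)) /eqP.
by rewrite coef_grade eqxx mcoeff0 mcoeff_eq0 mf.
Qed.

Lemma grade_low_cancel C f b d : (grade C b)`_0 != 0 ->
  (forall j, (j < d)%N -> (grade C (b * f))`_j = 0) ->
  forall j, (j < d)%N -> (grade C f)`_j = 0.
Proof. by rewrite gradeM; apply: coef_low_cancel. Qed.

Variable r : rel 'I_N.
Hypotheses (rI : irreflexive r) (rS : forall x y, r x y = r y x).
Local Notation I := (@rel_ideal K N r).

Lemma rel_ideal_edge m i j : r i j -> (0 < m i)%N -> (0 < m j)%N -> I (X m).
Proof.
move=> rij mi mj; have ij : i != j by apply: contraTneq rij => ->; rewrite rI.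
have /(packs_rel_pow K) := packs_edge ij rij mi mj.
apply: ideal_gen_min; first exact: ideal_gen0.
- by move=> x y; apply: ideal_genD.
- by move=> c x; apply: ideal_genMl.
by move=> _ [f fI ->]; rewrite big_ord1.
Qed.

Lemma rel_ideal_msuppP f m : I f -> m \in msupp f ->
  exists i j, [/\ r i j, (0 < m i)%N & (0 < m j)%N].
Proof.
move=> If mf; have [s [ss sr h]] := rel_ideal_msupp rI If mf.
case: s ss sr h => [|e [|//]] //= _ /andP[re _] h.
exists e.1, e.2; split => //.
  by apply: leq_trans (h e.1); rewrite /load big_seq1 eqxx.
by apply: leq_trans (h e.2); rewrite /load big_seq1 eqxx addn1.
Qed.

Lemma weight_gt0P C m :
  reflect (exists2 i, i \in C & (0 < m i)%N) (0 < weight C m)%N.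
Proof.
rewrite lt0n /weight sum_nat_eq0 negb_forall.
apply: (iffP existsP) => -[i].
  by rewrite negb_imply -lt0n => /andP[]; exists i.
by move=> iC mi; exists i; rewrite negb_imply iC -lt0n.
Qed.

Definition minimal_cover C : Prop :=
  cover r C /\ forall i, i \in C -> exists2 j, j \notin C & r i j.

(** Minimality appears in [minimal_cover] through private neighbours: a vertex of
    the cover without a neighbour outside could be dropped. *)
Lemma cover_minimal C : cover r C -> exists2 D, minimal_cover D & D \subset C.
Proof.
move=> /minset_exists [D /minsetP[/coverP Dc Dmin] sDC]; exists D => //; split.
  exact/coverP.
move=> i iD; apply: contrapT => noj.
have DDi : D :\ i = D.
  apply: Dmin; last exact: subD1set.
  apply/coverP => x y rxy; rewrite !in_setD1.
  have nbr z : z \in D -> r i z -> z != i.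
    by move=> zD; apply: contraTneq => ->; rewrite rI.
  have inD z : r i z -> z \in D.
    by move=> riz; apply: contrapT => /negP zD; apply: noj; exists z.
  case: (eqVneq x i) rxy => [->|xi] rxy /=.
    by have yD := inD _ rxy; rewrite yD (nbr _ yD rxy).
  case: (eqVneq y i) rxy => [->|yi] rxy /=.
    by rewrite inD // rS.
  exact: Dc.
by move: iD; rewrite -DDi in_setD1 eqxx.
Qed.

Section MinimalPrime.
Variable C : {set 'I_N}.
Hypothesis Cmin : minimal_cover C.

Let outside : multinom N := Multinom [tuple ((i \notin C) : nat) | i < N].

Let outsideE i : outside i = (i \notin C).
Proof. by rewrite multinomE tnth_mktuple. Qed.

(** The complement of a minimal cover is stable, and the product of its
    variables turns a monomial into an element of [I] as soon as the monomial
    involves a variable of the cover.  So the colon ideal of [I] by this product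
    is the prime generated by the cover. *)
Lemma colon_minimal_cover f : I (f * X outside) <-> (grade C f)`_0 = 0.
Proof.
have [/coverP Cc Cn] := Cmin.
have -> : (grade C f)`_0 = 0 <-> forall m, m \in msupp f -> (0 < weight C m)%N.
  by rewrite (grade_low C f 1); split=> [f0 [|//]|]// ->.
split=> [If m mf|h].
  have mf' : mnm_add outside m \in msupp (f * X outside).
    by rewrite mcoeff_msupp mcoeffMX -mcoeff_msupp.
  have [i [j [rij mi mj]]] := rel_ideal_msuppP If mf'.
  apply/weight_gt0P; move: mi mj; rewrite !mnmDE !outsideE.
  by have /orP[iC|jC] := Cc i j rij; [exists i|exists j] => //;
     rewrite ?iC ?jC in mi mj *; case: (i \in C) (j \in C).
rewrite [f]mpolyE mulr_suml big_seq; apply: (big_ind I).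
- exact: ideal_gen0.
- by move=> x y; apply: ideal_genD.
move=> m /h /weight_gt0P[i iC mi]; have [j jC rij] := Cn i iC.
rewrite -mul_mpolyC -mulrA -mpolyXD; apply: ideal_genMl.
apply: (rel_ideal_edge rij); rewrite !mnmDE ?outsideE ?jC ?addn1 //.
by rewrite (leq_trans mi) // leq_addr.
Qed.

Let P : set A := [set g | I (g * X outside)]%classic.

Lemma Ass_minimal_cover : Ass I P.
Proof.
split; last by exists (X outside).
apply: (prime_ideal_ker (g := fun g => (grade C g)`_0)).
- exact: grade0D.
- exact (grade0M C).
- by rewrite /grade mmap0 coef0.
- apply/eqP => h.
  have /(_ mnm0) : forall m, m \in msupp (mpolyC N (1 : K)) -> (0 < weight C m)%N.
    by apply/grade_low => -[|//] _; rewrite mpolyC1.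
  by rewrite msupp1 inE eqxx => /(_ isT) /weight_gt0P[i _]; rewrite mnm0E.
exact: colon_minimal_cover.
Qed.

(** Locally at the prime of [C], an element of the symbolic power becomes one of
    [I ^ d] after multiplication by some [b] outside of the prime.  Each of the
    [d] edges of a monomial of the product meets [C], and the order of vanishing
    of [grade C b] is zero. *)
Lemma symbolic_pow_weight d f m :
  symbolic_pow I d f -> m \in msupp f -> (d <= weight C m)%N.
Proof.
move=> sf; move: m; apply/grade_low.
have [b nPb Ibf] :=
  extension_ideal_gen Ass_minimal_cover.1 (sf P Ass_minimal_cover).
apply: (@grade_low_cancel C f b d).
  by apply/negP => /eqP /colon_minimal_cover.
apply/grade_low => m mbf; have [Cc _] := Cmin.
have [s [<- sr sm]] := rel_pow_msupp rI Ibf mbf.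
have : (\sum_(i in C) load s i <= weight C m)%N by apply: leq_sum.
apply: leq_trans; rewrite exchange_big /= -sum1_size big_seq [leqRHS]big_seq.
apply: leq_sum => e /(allP sr) /(coverP _ _ Cc) /orP[] eC.
  by rewrite (bigD1 e.1) //= eqxx.
by rewrite (bigD1 e.2) //= eqxx addn1.
Qed.

End MinimalPrime.

Lemma symbolic_pow_sub_pow d t :
  (forall a : 'I_N -> nat, (forall C, cover r C -> (d <= weight C a)%N) ->
     packs r a t) ->
  (symbolic_pow I d `<=` ideal_pow I t)%classic.
Proof.
move=> h f sf; apply: ideal_of_msupp => m mf; apply: packs_rel_pow; apply: h.
move=> C /cover_minimal[D Dmin sDC].
apply: leq_trans (symbolic_pow_weight Dmin sf mf) _.
by rewrite /weight [leqRHS](big_setID D) /= (setIidPr sDC) leq_addr.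
Qed.

(** An associated prime is the annihilator modulo [I] of some [f].  Choose a
    monomial [u] of [f] outside of [I]: its support is stable.  If [x_i f] is in [I] then [i] has a
    neighbour [z] in the support of [u], and [x_z f] is not in [I], for otherwise
    [z] would also have a neighbour there. *)
Lemma Ass_cover P : Ass I P -> minimal_cover [set i | `[< P (X (mnm1 i)) >]].
Proof.
move=> [pP [f PE]]; set C := [set i | _].
have inC i : (i \in C) = `[< P (X (mnm1 i)) >] by rewrite inE.
split.
  apply/coverP => i j rij; rewrite !inC.
  have : P (X (mnm1 i) * X (mnm1 j)).
    rewrite PE /= mulrC; apply: ideal_genMl; rewrite -mpolyXD.
    by apply: (rel_ideal_edge rij); rewrite mnmDE !mnm1E eqxx ?addn1.
  by move=> /(prime_idealP pP)[/asboolT ->|/asboolT ->]; rewrite ?orbT.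
have [u uf nIu] : exists2 u, u \in msupp f & ~ I (X u).
  apply: contrapT => h; apply: (prime_ideal1 pP); rewrite PE /= mul1r.
  apply: ideal_of_msupp => u uf; apply: contrapT => nIu; apply: h.
  by exists u.
have nbr i : i \in C -> exists2 z, r i z & (0 < u z)%N.
  rewrite inC => /asboolP; rewrite PE /= => If.
  have mf : mnm_add (mnm1 i) u \in msupp ((X (mnm1 i) : A) * f).
    by rewrite mcoeff_msupp mulrC mcoeffMX -mcoeff_msupp.
  have [x [y [rxy]]] := rel_ideal_msuppP If mf.
  rewrite !mnmDE !mnm1E.
  case: (eqVneq i x) => [ix|_]; case: (eqVneq i y) => [iy|_]; rewrite ?add0n.
  - by move: rxy; rewrite -ix -iy rI.
  - by exists y; rewrite ?ix.
  - by exists x => //; rewrite rS iy.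
  by move=> ux uy; case: nIu; apply: (rel_ideal_edge rxy).
move=> i iC; have [z riz uz] := nbr i iC; exists z => //.
apply/negP => /nbr[z' rzz' uz']; apply: nIu; exact: (rel_ideal_edge rzz').
Qed.

Lemma packs_sum (J : finType) (Q : pred J) (F : J -> multinom N) (t : J -> nat) :
  (forall j, Q j -> packs r (F j) (t j)) ->
  packs r (\big[@mnm_add N/mnm0]_(j | Q j) F j) (\sum_(j | Q j) t j)%N.
Proof.
move=> h; apply: (big_ind2 (fun (m : multinom N) n => packs r m n)) => //.
  exact: packs0.
by move=> m t1 m' t2; apply: packs_add.
Qed.

Lemma packs_muln m t k : packs r m t -> packs r (mnm_muln m k) (k * t)%N.
Proof.
move=> h; elim: k => [|k IHk]; first exact: packs0.
by rewrite mulmS mulSn; apply: packs_add.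
Qed.

(** At an associated prime with cover [C], each [i] in [C] has a neighbour [z i]
    whose variable is invertible there.  Multiplying by a power of these variables
    completes every variable of [C] to an edge. *)
Lemma symbolic_powX m d :
  (forall C, cover r C -> (d <= weight C m)%N) -> symbolic_pow I d (X m).
Proof.
move=> hm P AP; have [Cc Cn] := Ass_cover AP; set C := [set i | _] in Cc Cn.
have [pP _] := AP.
have Cn' i : exists j, i \in C -> j \notin C /\ r i j.
  have [/Cn[j]|_] := boolP (i \in C); last by exists i.
  by exists j.
have [z zP] := boolp.choice Cn'.
pose mb := \big[@mnm_add N/mnm0]_(i in C) mnm_muln (mnm1 (z i)) (m i).
apply: (@extensionMl _ P _ (X mb)).
- rewrite -mprodXE; apply: (big_ind (fun x => ~ P x)).
  + exact: prime_ideal1.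
  + by move=> x y nx ny /(prime_idealP pP)[].
  move=> i /zP[]; rewrite inE => /asboolP nPz _; rewrite -mpolyXn.
  elim: (m i) => [|k IHk]; first exact: prime_ideal1.
  by rewrite exprS => /(prime_idealP pP)[].
- by have [[/set_mem]] := pP.
rewrite -mpolyXD; apply: packs_rel_pow.
apply: (packs_leq (hm C Cc)).
pose F i := mnm_add (mnm1 (z i)) (mnm1 i).
have [s [st sr sm]] : packs r
   (\big[@mnm_add N/mnm0]_(i in C) mnm_muln (F i) (m i)) (\sum_(i in C) m i * 1)%N.
  apply: packs_sum => i /zP[zC riz]; apply: packs_muln.
  have zi : i != z i by apply: contraTneq riz => <-; rewrite rI.
  by apply: (packs_edge zi riz); rewrite mnmDE !mnm1E eqxx ?addn1.
exists s; split => //; first by rewrite st; apply: eq_bigr => i _; rewrite muln1.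
move=> v; apply: leq_trans (sm v) _.
rewrite mnmDE !mnm_sumE -[m v]/(m v).
rewrite (eq_bigr (fun i => mnm_muln (mnm1 (z i)) (m i) v + (i == v) * m i)%N).
  rewrite big_split /= leq_add2l.
  have [vC|vC] := boolP (v \in C).
    by rewrite (bigD1 v) //= eqxx mul1n big1 ?addn0 // => i /andP[_ /negbTE ->].
  by rewrite big1 // => i iC; case: eqP iC vC => // -> ->.
by move=> i _; rewrite !mulmnE mnmDE mulnDl !mnm1E.
Qed.

Lemma symbolic_pow_not_sub m d t :
  (forall C, cover r C -> (d <= weight C m)%N) -> ~ packs r m t ->
  ~ (symbolic_pow I d `<=` ideal_pow I t)%classic.
Proof.
move=> hm np /(_ _ (symbolic_powX hm)) /(rel_pow_msupp rI)/(_ m).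
by rewrite msuppX inE eqxx => /(_ isT).
Qed.

End SymbolicPowers.

(** * Stable sets and packings by edges and odd cycles *)

Section StableSets.
Variables (T : finType) (G : sgraph T).
Implicit Types (a b : T -> nat) (S : {set T}).

Lemma adjC x y : adj G x y = adj G y x.
Proof. by rewrite /adj setUC. Qed.

Lemma adj_card x y : adj G x y -> (x != y) && (x \in vset G) && (y \in vset G).
Proof.
move=> e; have /andP[] := forall_inP (valP G) _ e.
rewrite cards2 eqSS eqb1 => -> /subsetP h.
by rewrite !h ?inE ?eqxx ?orbT.
Qed.

Lemma adj_neq x y : adj G x y -> x != y.
Proof. by case/adj_card/andP => /andP[]. Qed.

Lemma adj_vset x y : adj G x y -> x \in vset G.
Proof. by case/adj_card/andP => /andP[]. Qed.

Lemma adj_vsetr x y : adj G x y -> y \in vset G.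
Proof. by rewrite adjC => /adj_vset. Qed.

Lemma adjxx x : adj G x x = false.
Proof. by apply/negP => /adj_neq; rewrite eqxx. Qed.

Definition stable S : bool :=
  (S \subset vset G) && [forall x in S, forall y in S, ~~ adj G x y].

Lemma stableP S :
  reflect (S \subset vset G /\ forall x y, x \in S -> y \in S -> ~~ adj G x y)
          (stable S).
Proof.
apply: (iffP andP) => -[-> h]; split=> //.
  by move=> x y xS yS; apply: (forall_inP (forall_inP h x xS) y yS).
by apply/forall_inP => x xS; apply/forall_inP => y yS; apply: h.
Qed.

Lemma stable0 : stable set0.
Proof. by apply/stableP; split=> [|x y]; rewrite ?sub0set ?inE. Qed.

(** Stable sets are the complements of covers, so
    [weight (vset G) a - alpha a] is the least weight of a vertex cover. *)
Definition alpha a : nat := \max_(S | stable S) weight S a.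

Definition optimal a S : bool := stable S && (weight S a == alpha a).

Lemma alpha_ge a S : stable S -> weight S a <= alpha a.
Proof. by move=> sS; apply: (@leq_bigmax_cond _ stable (fun S => weight S a)). Qed.

Lemma alpha_le a k : (forall S, stable S -> weight S a <= k) -> alpha a <= k.
Proof. by move=> h; apply/bigmax_leqP. Qed.

Lemma alpha_attained a : exists S, optimal a S.
Proof.
have [|S sS aS] := @eq_bigmax_cond _ stable (fun S => weight S a).
  by apply/card_gt0P; exists set0; apply: stable0.
by exists S; rewrite /optimal /alpha aS eqxx andbT; apply: sS.
Qed.

Lemma weight_mkcond S a : weight S a = \sum_v (v \in S) * a v.
Proof.
rewrite /weight big_mkcond; apply: eq_bigr => v _.
by case: (v \in S); rewrite ?mul1n.
Qed.

Lemma weightU1 S a u : u \notin S -> weight (u |: S) a = a u + weight S a.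
Proof. by move=> uS; rewrite /weight big_setU1. Qed.

(** Otherwise exchanging the neighbours of [u], all of weight zero, for [u] itself
    would increase the weight. *)
Lemma optimal_dominated a S u : u \in vset G -> 0 < a u -> u \notin S ->
  (forall y, y \in S -> adj G u y -> a y = 0) -> ~~ optimal a S.
Proof.
move=> uG au uS h; apply/negP => /andP[/stableP[sS Sadj] /eqP oS].
pose D := [set y in S | ~~ adj G u y].
have sD : stable (u |: D).
  apply/stableP; split.
    rewrite subUset sub1set uG; apply/subsetP => y.
    by rewrite inE => /andP[/(subsetP sS)].
  move=> x y; rewrite !inE.
  move=> /orP[/eqP -> | /andP[xS nx]] /orP[/eqP -> | /andP[yS ny]] //.
  - by rewrite adjxx.
  - by rewrite adjC.
  exact: Sadj.
have uD : u \notin D by rewrite inE (negbTE uS).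
have := alpha_ge a sD; rewrite weightU1 // -oS.
have -> : weight S a = weight D a.
  rewrite /weight (bigID (adj G u)) /= big1 => [|y /andP[]]; last exact: h.
  by apply: eq_bigl => y; rewrite inE.
by rewrite -[leqRHS]add0n leq_add2r leqNgt au.
Qed.

Lemma weight_exchange a (S1 S2 X Y : {set T}) :
  (forall v, (v \in X) + (v \in Y) = (v \in S1) + (v \in S2)) ->
  weight X a + weight Y a = weight S1 a + weight S2 a.
Proof.
move=> h; rewrite !weight_mkcond -!big_split /=.
by apply: eq_bigr => v _; rewrite -!mulnDl h.
Qed.

(** The uncrossing principle: two stable sets that together use every vertex as
    often as two optimal ones are optimal too. *)
Lemma optimal_exchange a (S1 S2 X Y : {set T}) : optimal a S1 -> optimal a S2 ->
  stable X -> stable Y ->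
  (forall v, (v \in X) + (v \in Y) = (v \in S1) + (v \in S2)) -> optimal a X.
Proof.
move=> /andP[_ /eqP o1] /andP[_ /eqP o2] sX sY /(weight_exchange a).
rewrite o1 o2 /optimal sX /= => h; rewrite eqn_leq alpha_ge //=.
by rewrite -(leq_add2r (alpha a)) -h leq_add2l alpha_ge.
Qed.

Section Packable.
Variables (n : nat) (Cyc : {set T} -> Prop).

(** The packing reaches the least weight of a vertex cover, when an edge counts
    for 1 and a member of [Cyc], meant to be the vertex set of a (2n+1)-cycle,
    for n+1. *)
Definition packable a : Prop :=
  exists (E : seq (T * T)) (L : seq {set T}),
    [/\ all (fun e => adj G e.1 e.2) E, (forall C, C \in L -> Cyc C),
        (forall v, load E v + count (fun C : {set T} => v \in C) L <= a v) &
        weight (vset G) a <= alpha a + size E + n.+1 * size L].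

Lemma packable0 a : weight (vset G) a = 0 -> packable a.
Proof.
move=> a0; exists [::], [::].
by split=> //= [v|]; rewrite /load ?big_nil ?a0.
Qed.

(** No vertex and no edge of the support meets all optimal stable sets. *)
Definition irreducible a : Prop :=
  (forall u, u \in vset G -> 0 < a u -> exists2 S, optimal a S & u \notin S) /\
  (forall u v, adj G u v -> 0 < a u -> 0 < a v ->
     exists2 S, optimal a S & (u \notin S) && (v \notin S)).

Lemma alpha_lt a b : (forall v, b v <= a v) ->
  (forall S, optimal a S -> weight S b < alpha a) -> alpha b < alpha a.
Proof.
move=> le_ba h; have [S /andP[sS /eqP <-]] := alpha_attained b.
have [oS|] := boolP (optimal a S); first exact: h.
rewrite /optimal sS /= => ne.
apply: leq_ltn_trans (_ : weight S a < _); rewrite ?leq_sum //.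
by rewrite ltn_neqAle ne alpha_ge.
Qed.

Lemma weight_sub1 a S u : 0 < a u -> u \in S ->
  weight S (fun x => a x - (x == u)) = (weight S a).-1.
Proof.
move=> au uS; rewrite /weight !(bigD1 u uS) /= eqxx subn1.
rewrite (eq_bigr a) => [|x /andP[_ /negbTE ->]]; last by rewrite subn0.
by case: (a u) au.
Qed.

Lemma weight_sub1_le a S u : weight S (fun x => a x - (x == u)) <= weight S a.
Proof. by apply: leq_sum => x _; apply: leq_subr. Qed.

(** Induction on the total weight: if a vertex or an edge of the support meets all
    optimal stable sets, lowering its weights by one lowers [alpha] by at least
    one.  For a vertex the least weight of a cover does not drop; for an edge it
    drops by at most one, which is paid for by putting the edge into the
    packing. *)
Lemma packable_irreducible :
  (forall a, irreducible a -> packable a) -> forall a, packable a.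
Proof.
move=> irr a; have [k] := ubnP (weight (vset G) a); elim: k a => // k IHk a.
rewrite ltnS => le_ak.
have wS u S : u \in S -> 0 < a u -> 0 < weight S a.
  by move=> uS au; rewrite /weight (bigD1 u uS) /= ltn_addr.
have [[u [uG au hu]]|nov] := pselect (exists u, [/\ u \in vset G, 0 < a u &
   forall S, optimal a S -> u \in S]).
  pose b x := a x - (x == u).
  have wb := weight_sub1 au uG; have wu := wS _ _ uG au.
  have [|E [L [Eadj LC load_le tight]]] := IHk b; first by rewrite wb prednK.
  exists E, L; split=> //.
    by move=> v; apply: leq_trans (load_le v) _; apply: leq_subr.
  have : alpha b < alpha a.
    apply: alpha_lt => [v|S oS]; first exact: leq_subr.
    rewrite (weight_sub1 au (hu S oS)) prednK ?(wS _ _ (hu S oS)) //.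
    by case/andP: oS => _ /eqP ->.
  by move: tight; rewrite wb; lia.
have [[u [v [uv au av huv]]]|noe] := pselect (exists u v, [/\ adj G u v, 0 < a u,
   0 < a v & forall S, optimal a S -> (u \in S) || (v \in S)]).
  pose b x := a x - (x == u); pose c x := b x - (x == v).
  have neq_uv := adj_neq uv; have uG := adj_vset uv.
  have vG := adj_vsetr uv.
  have bv : 0 < b v by rewrite /b eq_sym (negbTE neq_uv) subn0.
  have wb := weight_sub1 au uG; have wc := weight_sub1 bv vG.
  have wu := wS _ _ uG au.
  have wv : 0 < weight (vset G) b by rewrite /weight (bigD1 v vG) /= ltn_addr.
  have [|E [L [Eadj LC load_le tight]]] := IHk c; first by rewrite wc wb; lia.
  exists ((u, v) :: E), L; split=> //=; first by rewrite uv.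
    move=> x; have := load_le x; rewrite /load big_cons /= /c /b.
    rewrite [u == x]eq_sym [v == x]eq_sym.
    case: (eqVneq x u) => [->|_]; rewrite ?(negbTE neq_uv); first by lia.
    by case: (eqVneq x v) => [->|_]; lia.
  have : alpha c < alpha a.
    apply: alpha_lt => [x|S oS]; first by rewrite /c /b -subnDA leq_subr.
    have /eqP <- : weight S a == alpha a by case/andP: oS.
    have [uS|uS] := boolP (u \in S).
      apply: leq_ltn_trans (weight_sub1_le b S v) _.
      by rewrite (weight_sub1 au uS) prednK ?(wS _ _ uS).
    have vS : v \in S by have := huv S oS; rewrite (negbTE uS).
    rewrite (weight_sub1 bv vS) prednK; first exact: weight_sub1_le.
    by rewrite /weight (bigD1 v vS) /= ltn_addr.
  by move: tight; rewrite wc wb; lia.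
apply: irr; split=> [u uG au|u v uv au av].
  apply: contrapT => h; apply: nov; exists u; split=> // S oS.
  by apply: contrapT => /negP uS; apply: h; exists S.
apply: contrapT => h; apply: noe; exists u, v; split=> // S oS.
by apply: contrapT => /negP; rewrite negb_or => uS; apply: h; exists S.
Qed.

(** Optimal stable sets of a bipartite graph form a lattice under
    (S1 u S2) on one side and (S1 n S2) on the other.  If [u] had positive
    weight, joining optimal sets that avoid [u] and one neighbour each would give
    an optimal set that avoids [u] and all of its neighbours of positive weight,
    to which [u] could be added. *)
Lemma irreducible_bipartite a (A B : {set T}) :
  irreducible a -> vset G = A :|: B -> [disjoint A & B] ->
  (forall x y, adj G x y -> (x \in A) && (y \in B) || (x \in B) && (y \in A)) ->
  forall u, u \in A -> a u = 0.
Proof.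
move=> [irrv irre] GE dAB edge u uA.
apply/eqP; rewrite -leqn0 leqNgt; apply/negP => au.
have uG : u \in vset G by rewrite GE inE uA.
have BA v : v \in B -> v \in A = false.
  move=> vB; apply: contraTF dAB => vA; apply/pred0Pn.
  by exists v; apply/andP.
have AB v : v \in A -> v \in B = false.
  by move=> vA; apply/negP => /BA; rewrite vA.
have stable_AB (X : {set T}) : X \subset vset G ->
   (forall x y, x \in A -> y \in B -> x \in X -> y \in X -> ~~ adj G x y) ->
   stable X.
  move=> sX h; apply/stableP; split=> // x y xX yX; apply/negP => xy.
  have /orP[/andP[xA yB]|/andP[xB yA]] := edge x y xy.
    by have := h x y xA yB xX yX; rewrite xy.
  by have := h y x yA xB yX xX; rewrite adjC xy.
have opt_join S1 S2 : optimal a S1 -> optimal a S2 ->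
   optimal a (((S1 :|: S2) :&: A) :|: ((S1 :&: S2) :&: B)).
  move=> o1 o2.
  have /andP[/stableP[sS1 h1] _] := o1; have /andP[/stableP[sS2 h2] _] := o2.
  have sU : S1 :|: S2 \subset vset G by rewrite subUset sS1.
  have sI : S1 :&: S2 \subset vset G by rewrite subIset // sS1.
  apply: (optimal_exchange (Y := ((S1 :&: S2) :&: A) :|: ((S1 :|: S2) :&: B)) o1 o2).
  - apply: stable_AB.
      by rewrite subUset; apply/andP; split; apply: (subset_trans (subsetIl _ _)).
    move=> x y xA yB; rewrite !inE xA yB (BA _ yB) (AB _ xA) /=.
    rewrite !andbT !andbF ?orbF ?orFb.
    by move=> /orP[xS|xS] /andP[y1 y2]; [apply: h1|apply: h2].
  - apply: stable_AB.
      by rewrite subUset; apply/andP; split; apply: (subset_trans (subsetIl _ _)).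
    move=> x y xA yB; rewrite !inE xA yB (BA _ yB) (AB _ xA) /=.
    rewrite !andbT !andbF ?orbF ?orFb.
    by move=> /andP[x1 x2] /orP[yS|yS]; [apply: h1|apply: h2].
  move=> v; rewrite !inE.
  have [vG|vG] := boolP (v \in vset G); last first.
    by rewrite (contraNF (subsetP sS1 v) vG) (contraNF (subsetP sS2 v) vG).
  move: vG; rewrite GE inE => /orP[vA|vB].
    by rewrite vA (AB v vA); case: (v \in S1); case: (v \in S2).
  by rewrite vB (BA v vB); case: (v \in S1); case: (v \in S2).
have [S0 oS0 uS0] := irrv u uG au.
have [S oS [uS hS]] : exists2 S, optimal a S & u \notin S /\
   forall v, v \in enum [pred v | adj G u v && (0 < a v)] -> v \notin S.
  have : forall v, v \in enum [pred v | adj G u v && (0 < a v)] ->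
      adj G u v && (0 < a v).
    by move=> v; rewrite mem_enum.
  elim: (enum _) => [|v s IHs] hs; first by exists S0.
  have [S1 o1 [u1 h1]] : exists2 S, optimal a S & u \notin S /\
     forall v, v \in s -> v \notin S.
    by apply: IHs => w ws; apply: hs; rewrite inE ws orbT.
  have /andP[uv av] := hs v (mem_head _ _).
  have [S2 o2 /andP[u2 v2]] := irre u v uv au av.
  have nbrB w : adj G u w -> w \in A = false.
    by case/edge/orP => /andP[]; [move=> _ /BA|move=> /BA; rewrite uA].
  exists (((S1 :|: S2) :&: A) :|: ((S1 :&: S2) :&: B)); first exact: opt_join.
  split; first by rewrite !inE (negbTE u1) (negbTE u2).
  move=> w ws; have /andP[uw _] := hs w ws.
  rewrite !inE (nbrB w uw) andbF /=; move: ws; rewrite inE.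
  by move=> /orP[/eqP ->|/h1 /negbTE -> //]; rewrite (negbTE v2) andbF.
suff : ~~ optimal a S by rewrite oS.
apply: (optimal_dominated uG au uS).
move=> y yS uy; apply/eqP; rewrite -leqn0 leqNgt; apply/negP => ay.
by have := hS y; rewrite mem_enum inE uy ay yS => /(_ isT).
Qed.

End Packable.
End StableSets.

(** * Bipartite graphs *)

Section BipartitePieces.
Variables (T : finType) (G : sgraph T) (n : nat) (Cyc : {set T} -> Prop).

Lemma bipartite_edge (A B : {set T}) :
  (forall e, e \in eset G ->
     exists x y, [/\ x \in A, y \in B & e = [set x; y]]) ->
  forall x y, adj G x y -> (x \in A) && (y \in B) || (x \in B) && (y \in A).
Proof.
move=> h x y xy; have [x' [y' [x'A y'B exy]]] := h _ xy.
have nxy := adj_neq xy.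
have : x \in [set x'; y'] by rewrite -exy !inE eqxx.
have : y \in [set x'; y'] by rewrite -exy !inE eqxx orbT.
rewrite !inE => /orP[] /eqP yE /orP[] /eqP xE; move: nxy; rewrite xE yE ?eqxx //.
  by rewrite x'A y'B orbT.
by rewrite x'A y'B.
Qed.

Lemma packable_bipartite : bipartite G -> forall a, packable G n Cyc a.
Proof.
move=> [A [B [GE dAB h]]]; have edge := bipartite_edge h.
apply: packable_irreducible => a irr; apply: packable0; rewrite /weight GE.
apply: big1 => u; rewrite inE => /orP[uA|uB].
  exact: (irreducible_bipartite irr GE dAB edge uA).
have GE' : vset G = B :|: A by rewrite GE setUC.
apply: (irreducible_bipartite irr GE' _ _ uB); first by rewrite disjoint_sym.
by move=> x y /edge; rewrite orbC.
Qed.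

End BipartitePieces.

(** * Odd cycles *)

Lemma sum_odd_pairs (F : nat -> nat) n :
  \sum_(i < 2 * n + 1) F i = F 0 + \sum_(i < 2 * n + 1 | odd i) (F i + F i.+1).
Proof.
rewrite addn1 [in RHS]big_mkcond /=; elim: n => [|n IHn].
  by rewrite muln0 !big_ord1 addn0.
have -> : (2 * n.+1).+1 = (2 * n).+3 by rewrite mulnS.
rewrite !(big_ord_recr (2 * n).+2) !(big_ord_recr (2 * n).+1) /= IHn.
by rewrite mul2n /= odd_double /= addn0 -!addnA.
Qed.

Section Cycles.
Variables (T : finType) (G : sgraph T).

(** Indexing the vertices of an [m]-cycle by all naturals, modulo [m], makes every
    rotation a shift of the index. *)
Definition cyclic_walk (m : nat) (f : nat -> T) : Prop :=
  [/\ forall i j, (f i == f j) = (i == j %[mod m]),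
      forall x, x \in vset G <-> exists i, x = f i &
      forall i j, adj G (f i) (f j) = (f j == f i.+1) || (f i == f j.+1)].

Lemma is_cycle_walk m : is_cycle m G -> 3 <= m /\ exists f, cyclic_walk m f.
Proof.
move=> [c [m3 sc uc GV GE]]; split=> //.
have m0 : 0 < m by apply: leq_trans m3.
case: c sc uc GV GE => [|x0 c] sc uc GV GE; first by move: m0; rewrite -sc.
set d := x0 :: c in sc uc GV GE; pose f i := nth x0 d (i %% m).
have lt_mod i : i %% m < size d by rewrite sc ltn_pmod.
have fE i j : (f i == f j) = (i == j %[mod m]) by rewrite /f nth_uniq.
have in_f x : x \in d <-> exists i, x = f i.
  split=> [xd|[i ->]]; last by rewrite mem_nth.
  by exists (index x d); rewrite /f modn_small -?sc ?index_mem // nth_index.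
have nextf i : next d (f i) = f i.+1.
  rewrite next_nth mem_nth // index_uniq // -/d /f -[i.+1]addn1 -modnDml addn1.
  have := lt_mod i; rewrite sc leq_eqVlt => /orP[/eqP im|im].
    by rewrite im modnn /d /= nth_default // -ltnS im -sc.
  by rewrite [in RHS](modn_small im).
exists f; split=> // [x|i j]; first by rewrite GV inE.
have adjP x y :
    adj G x y <-> exists2 z, z \in d & [set x; y] = [set z; next d z].
  rewrite /adj GE; split=> [/imsetP[z zc ->]|[z zc ->]]; first by exists z.
  by apply/imsetP; exists z.
apply/idP/idP => [/adjP[z /in_f[k ->]]|].
  rewrite nextf => e.
  have : f i \in [set f k; f k.+1] by rewrite -e !inE eqxx.
  have : f j \in [set f k; f k.+1] by rewrite -e !inE eqxx orbT.
  have : f k \in [set f i; f j] by rewrite e !inE eqxx.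
  have : f k.+1 \in [set f i; f j] by rewrite e !inE eqxx orbT.
  have nk : f k == f k.+1 = false.
    rewrite fE -{1}[k]addn0 -[k.+1]addn1 eqn_modDl mod0n.
    by rewrite modn_small // (leq_trans _ m3).
  have succ i1 i2 : f i1 = f i2 -> f i1.+1 = f i2.+1.
    by move/eqP; rewrite fE -(eqn_modDr 1) !addn1 -fE => /eqP.
  rewrite !inE => h1 h0 _ /orP[/eqP ik|/eqP ik].
    move: h1; rewrite ik [_ == f k]eq_sym nk /= => /eqP <-.
    by rewrite (succ _ _ ik) eqxx.
  move: h0; rewrite ik nk /= => /eqP jk.
  by rewrite -(succ _ _ jk) eqxx orbT.
move=> /orP[/eqP e|/eqP e].
  apply/adjP; exists (f i); first by apply/in_f; exists i.
  by rewrite nextf e.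
apply/adjP; exists (f j); first by apply/in_f; exists j.
by rewrite nextf e setUC.
Qed.


Section Walk.
Variables (m : nat) (f : nat -> T).
Hypotheses (m0 : 0 < m) (W : cyclic_walk m f).

Lemma walk_eq i j : (f i == f j) = (i == j %[mod m]).
Proof. by case: W. Qed.

Lemma walk_inj i j : i < m -> j < m -> f i = f j -> i = j.
Proof. by move=> im jm /eqP; rewrite walk_eq !modn_small // => /eqP. Qed.

Lemma walk_mod i : f (i %% m) = f i.
Proof. by apply/eqP; rewrite walk_eq modn_mod. Qed.

Lemma walk_period i : f (i + m) = f i.
Proof. by apply/eqP; rewrite walk_eq modnDr. Qed.

Lemma walk_vset i : f i \in vset G.
Proof. by case: W => _ h _; apply/h; exists i. Qed.

Lemma walk_onto x : x \in vset G -> exists2 i, i < m & x = f i.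
Proof.
case: W => _ h _ /h[i ->]; exists (i %% m); first exact: ltn_pmod.
by rewrite walk_mod.
Qed.

Lemma walk_adj i : adj G (f i) (f i.+1).
Proof. by case: W => _ _ ->; rewrite eqxx. Qed.

Lemma walk_edge x y : adj G x y ->
  exists2 i, i < m & x = f i /\ y = f i.+1 \/ y = f i /\ x = f i.+1.
Proof.
move=> xy; have [i im xE] := walk_onto (adj_vset xy).
have [j jm yE] : exists2 j, j < m & y = f j.
  exact: walk_onto (adj_vsetr xy).
case: W => _ _ Wadj; move: xy; rewrite xE yE Wadj => /orP[/eqP e|/eqP e].
  by exists i => //; left.
by exists j => //; right.
Qed.

Lemma walk_sum (F : T -> nat) : \sum_(v in vset G) F v = \sum_(i < m) F (f i).
Proof.
have -> : vset G = [set f (val i) | i : 'I_m].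
  apply/setP => x; apply/idP/imsetP => [/walk_onto[i im ->]|[i _ ->]].
    by exists (Ordinal im).
  exact: walk_vset.
rewrite big_imset //= => i j _ _ /walk_inj h; apply: val_inj; exact: h.
Qed.

Lemma walk_weight (S : {set T}) a : S \subset vset G ->
  weight S a = \sum_(i < m) (f i \in S) * a (f i).
Proof.
move=> sS; rewrite -(walk_sum (fun v => (v \in S) * a v)) weight_mkcond.
rewrite [RHS]big_mkcond; apply: eq_bigr => v _; case: ifP => // /negP vG.
by case: (boolP (v \in S)) => // /(subsetP sS).
Qed.

Lemma walk_stable (S : {set T}) : S \subset vset G ->
  (forall i, i < m -> ~~ ((f i \in S) && (f i.+1 \in S))) -> stable G S.
Proof.
move=> sS h; apply/stableP; split=> // x y xS yS; apply/negP => xy.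
have [i im] := walk_edge xy; have := h i im.
by move=> + [[xE yE]|[yE xE]]; rewrite -xE -yE xS yS.
Qed.

Lemma walk_shift s : cyclic_walk m (fun i => f (i + s)).
Proof.
case: W => Weq Wonto Wadj; split=> [i j|x|i j].
- by rewrite Weq eqn_modDr.
- split=> [/Wonto[i ->]|[i ->]]; last exact: walk_vset.
  exists (i + (m - s %% m)); apply/eqP.
  rewrite walk_eq -modnDmr -addnA [_ + s %% m]subnK ?modnDr //.
  by rewrite ltnW // ltn_pmod.
by rewrite Wadj !addSn.
Qed.

(** A vertex of positive weight next to one of weight zero ends an edge, or is
    alone, in the support of the weights. *)
Lemma irreducible_walk_pos a : irreducible G a ->
  forall i j, 0 < a (f j) -> 0 < a (f i).
Proof.
move=> [irrv irre] i j aj; rewrite lt0n; apply/negP => /eqP ai.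
(* Walk from f i to f j: the weight becomes positive at some step. *)
have [k [ak ak1]] : exists k, a (f k) = 0 /\ 0 < a (f k.+1).
  apply: contrapT => h.
  have zero k : a (f (i + k)) = 0.
    elim: k => [|k IHk]; first by rewrite addn0.
    apply/eqP; rewrite -leqn0 leqNgt; apply/negP => pos; apply: h.
    by exists (i + k); rewrite -addnS.
  have := zero (m - i %% m + j); rewrite -walk_mod -modnDml addnA subnKC.
    by rewrite modnDl walk_mod => aj0; rewrite aj0 in aj.
  by rewrite ltnW // ltn_pmod.
have nbr y : adj G (f k.+1) y -> y = f k \/ y = f k.+2.
  move=> ky; have [l lm yE] := walk_onto (adj_vsetr ky).
  case: W ky => _ _ Wadj; rewrite yE Wadj => /orP[/eqP ->|]; first by right.
  by rewrite walk_eq -(addn1 k) -(addn1 l) eqn_modDr -walk_eq => /eqP ->; left.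
have [a2|a2] := posnP (a (f k.+2)).
  have [S oS uS] := irrv _ (walk_vset k.+1) ak1.
  suff : ~~ optimal G a S by rewrite oS.
  by apply: (optimal_dominated (walk_vset k.+1) ak1 uS) => y _ /nbr[] ->.
have [S oS /andP[uS vS]] := irre _ _ (walk_adj k.+1) ak1 a2.
suff : ~~ optimal G a S by rewrite oS.
apply: (optimal_dominated (walk_vset k.+1) ak1 uS) => y yS /nbr[] yE.
  by rewrite yE.
by rewrite yE (negbTE vS) in yS.
Qed.

End Walk.

(** Take optimal sets S and S', the first missing the adjacent vertices f (2n) and
    f 0, the second missing f 0 and f 1.  If some cut p with 0 < p < 2n could be
    used to follow S' up to p and S afterwards, uncrossing would give an optimal
    set that misses f 0 and both of its neighbours.  So at every p one of the sets
    contains f p and the other f (p+1), which forces S to consist of the vertices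
    of odd index. *)
Lemma walk_alternating_optimal n f a : 0 < n ->
  cyclic_walk (2 * n + 1) f -> irreducible G a -> (forall i, 0 < a (f i)) ->
  \sum_(j < 2 * n + 1 | odd j) a (f j) = alpha G a.
Proof.
move=> n0 W [irrv irre] apos; set m := 2 * n + 1 in W *.
have m0 : 0 < m by rewrite /m addn1.
have f2n1 : f (2 * n).+1 = f 0.
  by rewrite -addn1 -/m -[m]add0n (walk_period W).
have adj_last : adj G (f (2 * n)) (f 0) by rewrite -f2n1; apply: (walk_adj W).
have [S oS /andP[Sl S0]] := irre _ _ adj_last (apos _) (apos _).
have [S' oS' /andP[S'0 S'1]] := irre _ _ (walk_adj W 0) (apos _) (apos _).
have /andP[stS /eqP wS] := oS; have /andP[stS' _] := oS'.
have /stableP[sS Sadj] := stS; have /stableP[sS' S'adj] := stS'.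
have SS i : f i \in S -> f i.+1 \notin S.
  by move=> iS; apply/negP => i1S; have := Sadj _ _ iS i1S; rewrite (walk_adj W).
have SS' i : f i \in S' -> f i.+1 \notin S'.
  by move=> iS; apply/negP => i1S; have := S'adj _ _ iS i1S; rewrite (walk_adj W).
have illegal p : 0 < p -> p < 2 * n ->
    (f p \in S') && (f p.+1 \in S) || (f p \in S) && (f p.+1 \in S').
  move=> p0 p2n; apply/negPn/negP; rewrite negb_or => /andP[leg1 leg2].
  pose P : {set T} := [set f (val i) | i : 'I_p.+1].
  have inP i : i < m -> (f i \in P) = (i <= p).
    move=> im; apply/imsetP/idP => [[j _ /(walk_inj W im)->]|ip].
    - by rewrite -ltnS ltn_ord.
    - by apply: leq_trans (ltn_ord j) _; rewrite /m addn1 ltnS ltnW.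
    by exists (Ordinal (ip : i < p.+1)).
  (* [mix X Y] follows X up to the index p and Y beyond. *)
  pose mix (X Y : {set T}) := (X :&: P) :|: (Y :\: P).
  have in_mix (X Y : {set T}) i : i < m ->
      (f i \in mix X Y) = if i <= p then f i \in X else f i \in Y.
    move=> im; rewrite !inE inP //.
    by case: (i <= p); rewrite ?andbT ?andbF ?orbF.
  have st_mix (X Y : {set T}) : X \subset vset G -> Y \subset vset G ->
      (forall i, f i \in X -> f i.+1 \notin X) ->
      (forall i, f i \in Y -> f i.+1 \notin Y) ->
      f 0 \notin X -> ~~ ((f p \in X) && (f p.+1 \in Y)) -> stable G (mix X Y).
    move=> sX sY hX hY X0 leg; apply: (walk_stable m0 W).
      rewrite subUset (subset_trans (subsetIl _ _) sX).
      exact: subset_trans (subsetDl _ _) sY.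
    move=> i im; rewrite in_mix //.
    have [i1m|] := ltnP i.+1 m; last first.
      rewrite /m addn1 ltnS => im'.
      have -> : i = 2 * n.
        by apply/eqP; rewrite eqn_leq -ltnS -[(2 * n).+1]addn1 im im'.
      by rewrite f2n1 in_mix // (negbTE X0) andbF.
    rewrite in_mix //; case: (ltngtP i p) => [ip|pi|->].
    - by apply/negP => /andP[/hX /negP].
    - by apply/negP => /andP[/hY /negP].
    exact: leg.
  have oX : optimal G a (mix S' S).
    apply: (optimal_exchange (Y := mix S S') oS' oS).
    - exact: st_mix.
    - exact: st_mix.
    move=> v; rewrite !inE; case: (v \in P); rewrite ?andbT ?andbF ?orbF //=.
    by rewrite addnC.
  suff : ~~ optimal G a (mix S' S) by rewrite oX.
  apply: (optimal_dominated (walk_vset W 0) (apos 0)).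
    by rewrite in_mix // leq0n.
  move=> y yX /(walk_edge m0 W)[i im].
  have m1 : 1 < m by rewrite /m addn1 ltnS muln_gt0.
  case=> [[e0 yE]|[yE e0]].
    move: yX; rewrite yE -(walk_inj W m0 im e0) in_mix // p0.
    by rewrite (negbTE S'1).
  have iE : i = 2 * n.
    apply/eqP; move/eqP: e0; rewrite -f2n1 (walk_eq W) -!(addn1 (2 * n)) -[i.+1]addn1.
    by rewrite eqn_modDr !modn_small // ?/m ?addn1 // eq_sym.
  have lt2n : 2 * n < m by rewrite /m addn1.
  by move: yX; rewrite yE iE (in_mix _ _ _ lt2n) leqNgt p2n /= (negbTE Sl).
have alt j : 0 < j -> j <= 2 * n -> if odd j then f j \in S else f j \in S'.
  elim: j => // -[_ _ _|j IHj _ jn].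
    have := illegal 1 isT; rewrite (negbTE S'1) /= => h.
    have /h /andP[] : 1 < 2 * n by rewrite -[1.+1]/(2 * 1) leq_mul2l.
    by [].
  have := IHj isT (ltnW jn); have := illegal j.+1 isT jn; rewrite [odd j.+2]/= negbK.
  rewrite [odd j.+1]/=; case: (odd j) => /= [] h jS.
    by move: h; rewrite (negbTE (SS' _ jS)) andbF orbF => /andP[].
  by move: h; rewrite (negbTE (SS _ jS)) andbF => /andP[].
rewrite -wS (walk_weight m0 W) // big_mkcond /=.
apply: eq_bigr => -[j jm] _ /=.
have jn : j <= 2 * n by move: jm; rewrite /m addn1 ltnS.
have [->|j0] := posnP j.
  by rewrite /= (negbTE S0) mul0n.
have := alt j j0 jn; case: ifP => /= [_ ->|]; first by rewrite mul1n.
case: j j0 jn {jm} => [//|[//|j]] _ jn /= /negbFE oj _.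
have := alt j.+1 isT (ltnW jn); rewrite /= oj => /SS /negbTE ->.
by rewrite mul0n.
Qed.

(** By [walk_alternating_optimal] at every starting point, the total weight is the
    weight of that point plus twice [alpha].  Hence the weights are constant, and
    the packing consists of copies of the whole cycle. *)
Lemma packable_cycle n (Cyc : {set T} -> Prop) : 0 < n ->
  is_cycle (2 * n + 1) G -> Cyc (vset G) -> forall a, packable G n Cyc a.
Proof.
move=> n0 /is_cycle_walk[m3 [f W]] CG; apply: packable_irreducible => a irr.
have m0 : 0 < 2 * n + 1 by rewrite addn1.
have [apos|a0] := pselect (forall i, 0 < a (f i)); last first.
  apply: packable0; rewrite /weight (walk_sum m0 W); apply: big1 => i _.
  apply/eqP; rewrite -leqn0 leqNgt; apply/negP => ai; apply: a0 => j.
  exact: (irreducible_walk_pos m0 W irr j ai).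
have alt s : \sum_(j < 2 * n + 1 | odd j) a (f (j + s)) = alpha G a.
  exact: (walk_alternating_optimal n0 (walk_shift m0 W s)).
(* The sets of odd index seen from f s and from f (s+1) partition the vertices
   other than f s. *)
have total s : weight (vset G) a = a (f s) + (alpha G a).*2.
  rewrite /weight (walk_sum m0 (walk_shift m0 W s)).
  rewrite (sum_odd_pairs (fun i => a (f (i + s)))) big_split /= alt add0n.
  rewrite (eq_bigr (fun j : 'I_(2 * n + 1) => a (f (j + s.+1)))).
    by rewrite alt addnn.
  by move=> j _; rewrite addSnnS.
have const i : a (f i) = a (f 0).
  by apply/eqP; rewrite -(eqn_add2r (alpha G a).*2) -!total.
exists [::], (nseq (a (f 0)) (vset G)); split=> //.
- by move=> C /nseqP[->].
- move=> v; rewrite /load big_nil add0n count_nseq.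
  case: (boolP (v \in vset G)) => //= /(walk_onto m0 W)[i _ ->].
  by rewrite const mul1n.
rewrite size_nseq addn0 (total 0).
have <- : n * a (f 0) = alpha G a.
  rewrite -(alt 0) (eq_bigr (fun _ => a (f 0))); last first.
    by move=> i _; apply: const.
  have := sum_odd_pairs (fun _ => a (f 0)) n.
  rewrite sum_nat_const card_ord big_split /= mulnDl mul1n addnn -mulnA mul2n.
  rewrite addnC.
  by move/addnI/double_inj.
by lia.
Qed.

End Cycles.

(** * Clique-sums and their induced cycles *)

Section CliqueSums.
Variable T : finType.
Implicit Types (G H : sgraph T) (C : {set T}).

Lemma vset_gcup G1 G2 : vset (gcup G1 G2) = vset G1 :|: vset G2.
Proof. by []. Qed.

Lemma vset_gcap G1 G2 : vset (gcap G1 G2) = vset G1 :&: vset G2.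
Proof. by []. Qed.

Lemma adj_gcup G1 G2 x y : adj (gcup G1 G2) x y = adj G1 x y || adj G2 x y.
Proof. by rewrite /adj inE. Qed.

Lemma adj_gcap G1 G2 x y : adj (gcap G1 G2) x y = adj G1 x y && adj G2 x y.
Proof. by rewrite /adj inE. Qed.

Lemma vset_induced G C : C \subset vset G -> vset (induced G C) = C.
Proof. by move=> sC; apply/setIidPr. Qed.

Lemma adj_induced G C x y :
  adj (induced G C) x y = [&& adj G x y, x \in C & y \in C].
Proof. by rewrite /adj inE subUset !sub1set. Qed.

Lemma is_clique_sumC G1 G2 G : is_clique_sum G1 G2 G -> is_clique_sum G2 G1 G.
Proof.
have capC : gcap G1 G2 = gcap G2 G1 by apply: val_inj; congr pair; apply: setIC.
have cupC : gcup G1 G2 = gcup G2 G1 by apply: val_inj; congr pair; apply: setUC.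
by case; rewrite capC cupC.
Qed.

Definition is_induced H G : Prop :=
  vset H \subset vset G /\
  forall x y, x \in vset H -> y \in vset H -> adj G x y = adj H x y.

Lemma is_induced_trans G1 G2 G :
  is_induced G1 G2 -> is_induced G2 G -> is_induced G1 G.
Proof.
move=> [s1 a1] [s2 a2]; split; first exact: subset_trans s2.
by move=> x y xV yV; rewrite a2 ?a1 // (subsetP s1).
Qed.

Lemma all_adj_induced H G (E : seq (T * T)) : is_induced H G ->
  all (fun e => adj H e.1 e.2) E -> all (fun e => adj G e.1 e.2) E.
Proof.
move=> [_ iH] /allP h; apply/allP => e /h /= eH.
by rewrite iH // (adj_vset eH, adj_vsetr eH).
Qed.

Lemma is_induced_clique_sum G1 G2 G : is_clique_sum G1 G2 G -> is_induced G1 G.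
Proof.
case=> _ cK _ _ ->; split; first by rewrite vset_gcup subsetUl.
move=> x y x1 y1; rewrite adj_gcup; case: (boolP (adj G1 x y)) => //= n1.
apply/negP => a2; have y2 := adj_vsetr a2.
have := cK x y; rewrite !vset_gcap !inE x1 y1 y2 (adj_vset a2) adj_gcap (negbTE n1).
by move=> /(_ isT isT (adj_neq a2)).
Qed.

Lemma eq_sgraph G H :
  vset G = vset H -> (forall x y, adj G x y = adj H x y) -> G = H.
Proof.
move=> eqV eqE; apply: val_inj; rewrite [LHS]surjective_pairing.
rewrite [RHS]surjective_pairing -/(vset G) -/(vset H) -/(eset G) -/(eset H) eqV.
congr (_, _).
have cardE (F : sgraph T) e : e \in eset F -> exists x y, e = [set x; y].
  move=> eF; have /andP[/cards2P[x [y [_ ->]]] _] := forall_inP (valP F) e eF.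
  by exists x, y.
apply/setP => e; apply/idP/idP => eF; have [x [y exy]] := cardE _ _ eF.
  by rewrite exy -[_ \in _]/(adj H x y) -eqE /adj -exy.
by rewrite exy -[_ \in _]/(adj G x y) eqE /adj -exy.
Qed.

Lemma induced_is_induced H G C : is_induced H G -> C \subset vset H ->
  induced H C = induced G C.
Proof.
move=> [sH aH] sC; apply: eq_sgraph.
  by rewrite !vset_induced // (subset_trans sC).
move=> x y; rewrite !adj_induced andbC [RHS]andbC.
case: (boolP (x \in C)) => //= xC; case: (boolP (y \in C)) => //= yC.
by rewrite aH // (subsetP sC).
Qed.

Lemma induced_vset H : induced H (vset H) = H.
Proof.
apply: eq_sgraph; first exact: vset_induced.
move=> x y; rewrite adj_induced; case: (boolP (adj H x y)) => //= xy.
by rewrite (adj_vset xy) (adj_vsetr xy).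
Qed.

Lemma piece_is_induced s G :
  clique_sum_of s G -> forall H, H \in s -> is_induced H G.
Proof.
elim=> [G' H|s1 s2 G1 G2 G' _ IH1 _ IH2 sumG H]; first by rewrite inE => /eqP ->.
rewrite mem_cat => /orP[/IH1|/IH2] HG; apply: is_induced_trans HG _.
  exact: is_induced_clique_sum sumG.
exact: is_induced_clique_sum (is_clique_sumC sumG).
Qed.

Lemma step_change (P : pred nat) i j : i <= j -> P i -> ~~ P j ->
  exists k, [/\ i <= k, k < j, P k & ~~ P k.+1].
Proof.
move=> ij Pi; elim: j ij => [|j IHj].
  by rewrite leqn0 => /eqP <- /negP.
rewrite leq_eqVlt => /orP[/eqP <- /negP //|]; rewrite ltnS => ij nPj.
have [Pj|/(IHj ij)[k [ik kj Pk nPk]]] := boolP (P j); first by exists j.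
by exists k; split=> //; apply: ltnW.
Qed.

Lemma clique_sum_adj G1 G2 G x y : is_clique_sum G1 G2 G ->
  adj G x y -> x \notin vset G2 -> y \in vset G1.
Proof.
case=> _ _ _ _ ->; rewrite adj_gcup => /orP[/adj_vsetr //|/adj_vset ->//].
Qed.

(** A cycle with vertices x outside of G2 and y outside of G1 passes through the
    clique on both arcs between x and y.  The two vertices found there are
    adjacent, so they form a chord, as x and y separate them on the cycle. *)
Lemma induced_cycle_clique_sum G1 G2 G m C : is_clique_sum G1 G2 G ->
  C \subset vset G -> is_cycle m (induced G C) ->
  C \subset vset G1 \/ C \subset vset G2.
Proof.
move=> sumG sC /is_cycle_walk[m3 [g Wg]].
apply: contrapT => /not_orP[/negP/subsetPn[y yC y1] /negP/subsetPn[x xC x2]].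
have m0 : 0 < m by apply: leq_trans m3.
have [s sm xE] : exists2 s, s < m & x = g s.
  by apply: (walk_onto m0 Wg); rewrite vset_induced.
have [f W f0] : exists2 f, cyclic_walk (induced G C) m f & f 0 = x.
  by exists (fun i => g (i + s)); [exact: walk_shift|rewrite add0n].
have [q qm yE] : exists2 q, q < m & y = f q.
  by apply: (walk_onto m0 W); rewrite vset_induced.
have fm : f m = x by rewrite -f0 -[m]add0n (walk_period W).
have fC i : f i \in C by have := walk_vset W i; rewrite vset_induced.
have fadj i : adj G (f i) (f i.+1).
  by have := walk_adj W i; rewrite adj_induced => /and3P[].
have [p [_ pq p2 p2']] : exists k,
    [/\ 0 <= k, k < q, f k \notin vset G2 & ~~ (f k.+1 \notin vset G2)].
  apply: (@step_change (fun k => f k \notin vset G2)); rewrite ?f0 // negbK -yE.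
  have : y \in vset G by apply: (subsetP sC).
  by case: sumG => _ _ _ _ ->; rewrite vset_gcup inE (negbTE y1).
have [r [qr rm r1 r1']] : exists k,
    [/\ q <= k, k < m, f k \notin vset G1 & ~~ (f k.+1 \notin vset G1)].
  apply: (@step_change (fun k => f k \notin vset G1));
    rewrite -?yE ?(ltnW qm) // negbK fm.
  have : x \in vset G by apply: (subsetP sC).
  by case: sumG => _ _ _ _ ->; rewrite vset_gcup inE (negbTE x2) orbF.
rewrite negbK in p2'; rewrite negbK in r1'.
have p1' : f p.+1 \in vset G1 by apply: clique_sum_adj sumG (fadj p) p2.
have r2' : f r.+1 \in vset G2.
  by apply: clique_sum_adj (is_clique_sumC sumG) (fadj r) r1.
have p1q : p.+1 < q.
  rewrite ltn_neqAle pq andbT; apply: contraNneq y1 => pE.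
  by rewrite yE -pE.
have r1m : r.+1 < m.
  rewrite ltn_neqAle rm andbT; apply: contraNneq x2 => rE.
  by rewrite -fm -rE.
have p1m : p.+1 < m by apply: ltn_trans qm.
have pr : p.+1 != r.+1 by rewrite neq_ltn (leq_trans p1q) // ltnW.
have : adj (induced G C) (f p.+1) (f r.+1).
  rewrite adj_induced !fC !andbT; case: sumG => _ cK _ _ ->; rewrite adj_gcup.
  have := cK (f p.+1) (f r.+1); rewrite vset_gcap !inE p1' p2' r1' r2' adj_gcap.
  move=> /(_ isT isT); rewrite (walk_eq W) !modn_small // => /(_ pr).
  by case/andP => ->.
case: W => Weq _ ->; rewrite !Weq => /orP[].
  rewrite !modn_small // ?(leq_ltn_trans p1q) // => /eqP[rp].
  by move: p1q; rewrite ltnNge -rp (leq_trans qr).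
move: r1m; rewrite leq_eqVlt => /orP[/eqP ->|r2m].
  by rewrite modnn modn_small.
rewrite !modn_small // => /eqP[pE].
by move: p1q; rewrite pE ltnNge (leq_trans qr) // -addn2 leq_addr.
Qed.

Lemma induced_cycle_in_piece s G : clique_sum_of s G ->
  forall m C, C \subset vset G -> is_cycle m (induced G C) ->
  exists H, [/\ H \in s, C \subset vset H & is_cycle m (induced H C)].
Proof.
elim=> [G' m C sC cC|s1 s2 G1 G2 G' _ IH1 _ IH2 sumG m C sC cC].
  by exists G'; rewrite inE.
have i1 := is_induced_clique_sum sumG.
have i2 := is_induced_clique_sum (is_clique_sumC sumG).
have [sC1|sC2] := induced_cycle_clique_sum sumG sC cC.
  have [|H [Hs sH cH]] := IH1 m C sC1; first by rewrite (induced_is_induced i1).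
  by exists H; rewrite mem_cat Hs.
have [|H [Hs sH cH]] := IH2 m C sC2; first by rewrite (induced_is_induced i2).
by exists H; rewrite mem_cat Hs orbT.
Qed.

(** The sides alternate along the walk, which returns to its start after [m]
    steps. *)
Lemma bipartite_no_odd_cycle m H C : bipartite H -> C \subset vset H ->
  is_cycle m (induced H C) -> ~~ odd m.
Proof.
move=> [A [B [_ dAB /(@bipartite_edge _ H) edge]]] sC /is_cycle_walk[m3 [f W]].
have BA v : v \in B -> v \in A = false.
  move=> vB; apply: contraTF dAB => vA; apply/pred0Pn.
  by exists v; apply/andP.
have alt i : (f i \in A) = (f 0 \in A) (+) odd i.
  elim: i => [|i IHi]; first by rewrite addbF.
  have := walk_adj W i; rewrite adj_induced => /andP[/edge + _].
  rewrite /= addbN -IHi => /orP[] /andP[].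
    by move=> -> /BA ->.
  by move=> /BA -> ->.
have := alt m; rewrite -[m in f m]add0n (walk_period W).
by case: (f 0 \in A); case: (odd m).
Qed.

(** Every vertex of [C] has two neighbours in [C], which are its only two
    neighbours in the cycle [H]; so [C] is stable under the successor of [H]. *)
Lemma induced_cycle_of_cycle m l H C : is_cycle l H -> C \subset vset H ->
  is_cycle m (induced H C) -> C = vset H.
Proof.
move=> /is_cycle_walk[l3 [g Wg]] sC /is_cycle_walk[m3 [f Wf]].
have l0 : 0 < l by apply: leq_trans l3.
have m0 : 0 < m by apply: leq_trans m3.
have fC i : f i \in C by have := walk_vset Wf i; rewrite vset_induced.
have fadj i : adj H (f i) (f i.+1).
  by have := walk_adj Wf i; rewrite adj_induced => /and3P[].
have nbr j y : adj H (g j.+1) y -> y = g j \/ y = g j.+2.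
  move=> jy; have [k km yE] := walk_onto l0 Wg (adj_vsetr jy).
  case: (Wg) jy => _ _ Wadj; rewrite yE Wadj => /orP[/eqP ->|]; first by right.
  rewrite (walk_eq Wg) -(addn1 j) -(addn1 k) eqn_modDr -(walk_eq Wg).
  by move=> /eqP ->; left.
have succ j : g j.+1 \in C -> g j.+2 \in C.
  move=> jC; have [i im iE] : exists2 i, i < m & g j.+1 = f (i.+1).
    have [i im iE] : exists2 i, i < m & g j.+1 = f i.
      by apply: (walk_onto m0 Wf); rewrite vset_induced.
    case: i im iE => [|i] im iE; last by exists i => //; apply: ltnW.
    by exists m.-1; rewrite prednK // -[m]add0n (walk_period Wf).
  have := nbr j (f i); rewrite iE adjC fadj => /(_ isT)[fi|<- //].
  have := nbr j (f i.+2); rewrite iE fadj => /(_ isT)[fi2|<- //].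
  have : f i == f i.+2 by rewrite fi fi2.
  rewrite (walk_eq Wf) -{1}[i]addn0 -[i.+2]addn2 eqn_modDl mod0n.
  by rewrite modn_small // (leq_trans _ m3).
apply/eqP; rewrite eqEsubset sC; apply/subsetP => x /(walk_onto l0 Wg)[k kl ->].
have [j jl jE] : exists2 j, j < l & f 0 = g j.
  by apply: (walk_onto l0 Wg); apply: (subsetP sC).
(* Starting one full turn ahead keeps the index positive, as [succ] requires. *)
have all_succ i : g (j + l + i) \in C.
  elim: i => [|i IHi]; first by rewrite addn0 (walk_period Wg) -jE.
  have : 0 < j + l + i by rewrite !addn_gt0 l0 orbT.
  by move: IHi; rewrite addnS; case: (j + l + i) => // a /succ.
have := all_succ (l * (j + l) - (j + l) + k).
rewrite addnA subnKC; last by rewrite leq_pmull.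
by rewrite -(walk_mod Wg) mulnC modnMDl (walk_mod Wg).
Qed.

End CliqueSums.

(** * Packings in a clique-sum *)

Section PackableCliqueSum.
Variables (T : finType) (G1 G2 G : sgraph T) (n : nat) (Cyc : {set T} -> Prop).
Hypothesis sumG : is_clique_sum G1 G2 G.
Local Notation V1 := (vset G1).
Local Notation V2 := (vset G2).

(** Distinct vertices of the clique are adjacent in both graphs. *)
Lemma clique_sum_meet (S : {set T}) u : stable G1 S \/ stable G2 S ->
  u \in S -> u \in V1 :&: V2 -> forall v, v \in S -> v \in V1 :&: V2 -> v = u.
Proof.
move=> stS uS uK v vS vK; apply/eqP; apply/negPn/negP => vu.
case: sumG => _ cK _ _ _; have := cK v u vK uK vu; rewrite adj_gcap => /andP[a1 a2].
by case: stS => /stableP[_ /(_ v u vS uS)]; rewrite ?a1 ?a2.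
Qed.

Lemma clique_sum_glue (S S2 : {set T}) :
  S \subset V1 :\: V2 -> stable G1 S -> stable G2 S2 ->
  (forall u, u \in S2 -> u \in V1 -> stable G1 (u |: S)) -> stable G (S :|: S2).
Proof.
move=> sS /stableP[_ hS] /stableP[sS2 hS2] hu.
have inS x : x \in S -> (x \in V1) && (x \notin V2).
  by move=> /(subsetP sS); rewrite inE andbC.
have SS2 x y : x \in S -> y \in S2 -> ~~ adj G x y.
  move=> xS yS2; apply/negP => xy; have /andP[x1 x2] := inS x xS.
  have y1 : y \in V1 := clique_sum_adj sumG xy x2.
  have /stableP[_ /(_ x y)] := hu y yS2 y1.
  rewrite !inE xS eqxx orbT => /(_ isT isT).
  by have [_ <-] := is_induced_clique_sum sumG; rewrite ?xy.
apply/stableP; split.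
  case: sumG => _ _ _ _ ->; rewrite vset_gcup; apply: setUSS => //.
  by apply: subset_trans sS (subsetDl _ _).
move=> x y; rewrite !inE => /orP[xS|xS] /orP[yS|yS].
- have /andP[x1 _] := inS x xS; have /andP[y1 _] := inS y yS.
  by have [_ ->] := is_induced_clique_sum sumG; rewrite ?hS.
- exact: SS2.
- by rewrite adjC SS2.
have [_ ->] := is_induced_clique_sum (is_clique_sumC sumG); rewrite ?hS2 //.
  exact: (subsetP sS2).
exact: (subsetP sS2).
Qed.

Variable a : T -> nat.

(** [rest u] is the largest weight of a stable set of G1 off the clique, which is
    moreover compatible with the vertex v of the clique when [u] is [Some v]. *)
Let off (u : option T) (S : {set T}) : bool :=
  (S \subset V1 :\: V2) &&
  stable G1 (if u is Some v then v |: S else S).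

Let rest (u : option T) : nat := \max_(S | off u S) weight S a.

(** A vertex v of the clique keeps in G1 a weight equal to what its selection
    costs there off the clique, capped by [a v]; the remainder goes to G2.  So
    nothing is gained in G1 by using the clique, and what exceeds the cost is
    left for G2 to decide. *)
Let w1 (v : T) : nat :=
  if v \in V1 then
    if v \in V2 then minn (a v) (rest None - rest (Some v)) else a v
  else 0.

Let w2 (v : T) : nat := a v - w1 v.

Lemma stable_subset (H : sgraph T) (S S' : {set T}) :
  S' \subset S -> stable H S -> stable H S'.
Proof.
move=> /subsetP sub /stableP[sS hS]; apply/stableP; split.
  by apply: subset_trans sS; apply/subsetP.
by move=> x y /sub xS /sub yS; apply: hS.
Qed.

Let rest_ge u S : off u S -> weight S a <= rest u.
Proof. exact: (@leq_bigmax_cond _ (off u) (fun S => weight S a)). Qed.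

Let rest_attained u : (if u is Some v then v \in V1 else true) ->
  exists2 S, off u S & weight S a = rest u.
Proof.
move=> u1.
have [|S oS rE] := @eq_bigmax_cond _ (off u) (fun S => weight S a); last first.
  by exists S => //; apply/esym; apply: rE.
apply/card_gt0P; exists set0; rewrite unfold_in /off sub0set /=.
case: u u1 => [v v1|_]; last exact: stable0.
apply/stableP; rewrite setU0 sub1set; split=> // x y; rewrite !inE => /eqP -> /eqP ->.
by rewrite adjxx.
Qed.

Let rest_le v : rest (Some v) <= rest None.
Proof.
apply/bigmax_leqP => S /andP[sS stS]; apply: rest_ge; rewrite /off sS /=.
by apply: stable_subset stS; apply: subsetUr.
Qed.

Let alpha_w1 : alpha G1 w1 <= rest None.
Proof.
apply: alpha_le => S stS; have /stableP[sS _] := stS.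
have offK (S' : {set T}) : S' \subset S -> (forall v, v \in S' -> v \notin V2) ->
    S' \subset V1 :\: V2 /\ weight S' w1 = weight S' a.
  move=> sS' h; have s1 v : v \in S' -> v \in V1.
    by move=> vS; apply/(subsetP sS)/(subsetP sS').
  split; first by apply/subsetP => v vS; rewrite inE h ?s1.
  by apply: eq_bigr => v vS; rewrite /w1 s1 // (negbTE (h v vS)).
have [[u uS u2]|noK] := pselect (exists2 u, u \in S & u \in V2); last first.
  have [//|v vS|sS' ->] := offK S.
    by apply/negP => v2; apply: noK; exists v.
  by apply: rest_ge; rewrite /off sS'.
have u1 := subsetP sS u uS.
have [|v|sS' wS'] := offK (S :\ u); first exact: subsetDl.
  rewrite !inE => /andP[vu vS]; apply: contra vu => v2; apply/eqP.
  by apply: (clique_sum_meet (or_introl stS) uS) => //;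
    rewrite inE ?u1 ?(subsetP sS v vS).
rewrite -(setD1K uS) weightU1 ?in_setD1 ?eqxx // wS' /w1 u1 u2.
have : weight (S :\ u) a <= rest (Some u).
  by apply: rest_ge; rewrite /off sS' setD1K.
by have := rest_le u; lia.
Qed.

(** If [S] uses a vertex of the clique, either this vertex has weight zero for
    [w2] and can be dropped, or its cost in G1 is deducted in full from its
    weight and [S] extends by the best compatible stable set of G1. *)
Let alpha_w2 (S : {set T}) : stable G2 S -> rest None + weight S w2 <= alpha G a.
Proof.
move=> stS; have /stableP[sS _] := stS.
have w2E v : v \notin V1 -> w2 v = a v.
  by move=> v1; rewrite /w2 /w1 (negbTE v1) subn0.
have glue u S0 (S2 : {set T}) : off u S0 -> stable G2 S2 ->
    (forall v, v \in S2 -> v \in V1 -> stable G1 (v |: S0)) ->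
    weight S0 a + weight S2 a <= alpha G a.
  move=> /andP[sS0 stS0] stS2 h.
  have stS0' : stable G1 S0.
    by apply: stable_subset stS0; case: (u) => // v; apply: subsetUr.
  have dis : [disjoint S0 & S2].
    have /stableP[sS2 _] := stS2; rewrite disjoint_subset.
    apply/subsetP => v /(subsetP sS0).
    by rewrite !inE => /andP[v2 _]; apply: contra v2 => /(subsetP sS2).
  rewrite -[_ + _](_ : weight (S0 :|: S2) a = _); last first.
    by rewrite /weight -bigU //=; apply: eq_bigl => v; rewrite inE.
  by apply: alpha_ge; apply: clique_sum_glue.
have [[u uS u1]|noK] := pselect (exists2 u, u \in S & u \in V1); last first.
  have noK' v : v \in S -> v \notin V1.
    by move=> vS; apply/negP => v1; apply: noK; exists v.
  rewrite /weight (eq_bigr a) => [|v /noK' /w2E//].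
  have [//|S0 off0 <-] := @rest_attained None.
  by apply: (glue None) => // v /noK' /negbTE ->.
have u2 := subsetP sS u uS.
have noK v : v \in S :\ u -> v \notin V1.
  rewrite !inE => /andP[vu vS]; apply: contra vu => v1; apply/eqP.
  by apply: (clique_sum_meet (or_intror stS) uS) => //;
    rewrite inE ?u1 ?v1 ?(subsetP sS v vS).
have wSu : weight (S :\ u) w2 = weight (S :\ u) a.
  by apply: eq_bigr => v /noK /w2E.
rewrite -(setD1K uS) weightU1 ?in_setD1 ?eqxx // wSu {1}/w2 /w1 u1 u2.
have [le_au|lt_au] := leqP (a u) (rest None - rest (Some u)).
  have [//|S0 off0 <-] := @rest_attained None.
  rewrite subnn add0n; apply: (glue None) => //.
    by apply: stable_subset stS; apply: subsetDl.
  by move=> v /noK /negbTE ->.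
have [//|S0 off0 r0] := @rest_attained (Some u).
have := glue _ S0 S off0 stS; rewrite -{2}(setD1K uS) weightU1 ?in_setD1 ?eqxx // r0.
have := rest_le u; move: lt_au => + + H.
have /H : forall v, v \in S -> v \in V1 -> stable G1 (v |: S0).
  move=> v vS v1; have [->|vu] := eqVneq v u; first by case/andP: off0.
  by have := noK v; rewrite !inE vu vS v1 => /(_ isT).
by lia.
Qed.

Lemma packable_clique_sum : (forall b, packable G1 n Cyc b) ->
  (forall b, packable G2 n Cyc b) -> packable G n Cyc a.
Proof.
move=> /(_ w1) [E1 [L1 [E1adj L1C load1 tight1]]].
move=> /(_ w2) [E2 [L2 [E2adj L2C load2 tight2]]].
have w1a v : w1 v <= a v.
  by rewrite /w1; case: ifP => // _; case: ifP => // _; apply: geq_minl.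
exists (E1 ++ E2), (L1 ++ L2); split.
- rewrite all_cat (all_adj_induced (is_induced_clique_sum sumG) E1adj).
  exact: all_adj_induced (is_induced_clique_sum (is_clique_sumC sumG)) E2adj.
- by move=> C; rewrite mem_cat => /orP[/L1C|/L2C].
- move=> v; rewrite /load big_cat count_cat /= addnACA.
  apply: leq_trans (leq_add (load1 v) (load2 v)) _.
  by rewrite /w2 subnKC.
have : weight (vset G) a <= weight V1 w1 + weight V2 w2.
  case: sumG => _ _ _ _ ->; rewrite vset_gcup !weight_mkcond -big_split /=.
  apply: leq_sum => v _; rewrite inE /w2 /w1.
  case: (v \in V1); case: (v \in V2); rewrite ?mul1n ?mul0n ?addn0 ?subn0 //.
  by rewrite subnKC // geq_minl.
have [S2 /andP[stS2 /eqP oS2]] := alpha_attained G2 w2.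
have := alpha_w2 stS2; rewrite oS2 !size_cat; move: alpha_w1 tight1 tight2.
by rewrite mulnDr; lia.
Qed.

End PackableCliqueSum.

(** * Pairs of close odd cycles *)

Section OddCycles.
Variables (T : finType) (n : nat).
Implicit Types (G H : sgraph T) (C D : {set T}).

Definition odd_cycle_of G C : Prop :=
  exists H, [/\ is_induced H G, is_cycle (2 * n + 1) H & vset H = C].

Definition far G C D : bool :=
  [forall u in C, forall v in D, (u != v) && ~~ adj G u v].

Lemma farP G C D :
  reflect (forall u v, u \in C -> v \in D -> u != v /\ ~~ adj G u v) (far G C D).
Proof.
apply: (iffP forall_inP) => [h u v uC vD|h u uC].
  by apply/andP; apply: (forall_inP (h u uC)).
by apply/forall_inP => v vD; apply/andP/h.
Qed.

Lemma farC G C D : far G C D = far G D C.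
Proof.
by apply/farP/farP => h u v uC vD; have [] := h v u vD uC; rewrite eq_sym adjC.
Qed.

Lemma odd_cycle_walk H :
  is_cycle (2 * n + 1) H -> exists f, cyclic_walk H (2 * n + 1) f.
Proof. by case/is_cycle_walk. Qed.

Let m0 : 0 < 2 * n + 1. Proof. by rewrite addn1. Qed.

Lemma load_consecutive (f : nat -> T) k v :
  load [seq (f (2 * i + 1), f (2 * i + 2)) | i <- iota 0 k] v =
  count_mem v [seq f i | i <- iota 1 (2 * k)].
Proof.
elim: k => [|k IHk]; first by rewrite /load big_nil.
rewrite -[k.+1]addn1 iotaD map_cat /load big_cat -/(load _ v) IHk /= big_seq1 /= add0n.
rewrite mulnDr muln1 iotaD map_cat count_cat /= addn0.
by rewrite addn1 addn2 add1n.
Qed.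

(** The remaining path has 2n vertices: take every other edge. *)
Lemma cycle_minus_vertex H x : is_cycle (2 * n + 1) H -> x \in vset H ->
  exists E : seq (T * T), [/\ all (fun e => adj H e.1 e.2) E, size E = n &
    forall v, load E v <= (v \in vset H) && (v != x)].
Proof.
move=> /odd_cycle_walk[g Wg] /(walk_onto m0 Wg)[s _ ->].
have W := walk_shift m0 Wg s; set f := fun i => _ in W.
exists [seq (f (2 * i + 1), f (2 * i + 2)) | i <- iota 0 n]; split.
- by apply/allP => _ /mapP[i _ ->] /=; rewrite addn1 addn2; apply: (walk_adj W).
- by rewrite size_map size_iota.
move=> v; rewrite load_consecutive count_uniq_mem; last first.
  rewrite map_inj_in_uniq ?iota_uniq // => i j.
  rewrite !mem_iota => /andP[_ im] /andP[_ jm].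
  by apply: (walk_inj W); rewrite addnC.
case: mapP => // -[i]; rewrite mem_iota => /andP[i1 im] ->.
rewrite (walk_vset W) -[g s]/(f 0) (walk_eq W) mod0n modn_small 1?addnC //.
by rewrite -lt0n i1.
Qed.

(** An edge uv between the two cycles leaves two paths on 2n vertices.  When the
    cycles share a vertex, u is that vertex in the first one and v its successor
    in the second one, since the load counts both cycles. *)
Lemma pair_cycles G C D : odd_cycle_of G C -> odd_cycle_of G D -> ~~ far G C D ->
  exists E : seq (T * T), [/\ all (fun e => adj G e.1 e.2) E, size E = 2 * n + 1 &
    forall v, load E v <= (v \in C) + (v \in D)].
Proof.
move=> [H [iH cH <-]] [H' [iH' cH' <-]] nfar.
have [u [v [uH vH' uv]]] : exists u v, [/\ u \in vset H, v \in vset H' & adj G u v].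
  move: nfar; rewrite negb_forall => /existsP[u].
  rewrite negb_imply => /andP[uH].
  rewrite negb_forall => /existsP[v]; rewrite negb_imply => /andP[vH'].
  rewrite negb_and !negbK => /orP[/eqP uv|uv]; last by exists u, v.
  have [g Wg] := odd_cycle_walk cH'; have [s _ vs] := walk_onto m0 Wg vH'.
  exists u, (g s.+1); rewrite uH (walk_vset Wg); split=> //.
  have [_ ->] := iH'; rewrite ?uv ?vH' ?(walk_vset Wg) // vs.
  exact: (walk_adj Wg).
have [E [Ea Es El]] := cycle_minus_vertex cH uH.
have [E' [E'a E's E'l]] := cycle_minus_vertex cH' vH'.
exists ((u, v) :: E ++ E'); split.
- by rewrite /= uv all_cat !(all_adj_induced _ Ea, all_adj_induced _ E'a).
- by rewrite /= size_cat Es E's mul2n addnn addn1.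
move=> w; rewrite /load big_cons big_cat -/(load E w) -/(load E' w) /= addnACA.
apply: leq_add.
  apply: leq_trans (leq_add (leqnn _) (El w)) _; rewrite [u == w]eq_sym.
  by case: eqVneq => [->|_]; rewrite ?uH ?andbF ?andbT.
apply: leq_trans (leq_add (leqnn _) (E'l w)) _; rewrite [v == w]eq_sym.
by case: eqVneq => [->|_]; rewrite ?vH' ?andbF ?andbT.
Qed.

(** A new cycle is matched with a leftover cycle close to it if there is one, and
    becomes a leftover otherwise. *)
Lemma greedy_pairing G (L : seq {set T}) : (forall C, C \in L -> odd_cycle_of G C) ->
  exists (E : seq (T * T)) (R : seq {set T}) (p : nat),
    [/\ all (fun e => adj G e.1 e.2) E /\ (forall C, C \in R -> odd_cycle_of G C),
        pairwise (far G) R,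
        size E = (2 * n + 1) * p, size L = 2 * p + size R &
        forall v, load E v + count (fun C : {set T} => v \in C) R
                  <= count (fun C : {set T} => v \in C) L].
Proof.
elim: L => [|C L IHL] hL.
  exists [::], [::], 0; split=> //; first by rewrite muln0.
  by move=> v; rewrite /load big_nil.
have [|E [R [p [[Ea RC] Rfar Es Ls El]]]] := IHL.
  by move=> D DL; apply: hL; rewrite inE DL orbT.
have CC := hL C (mem_head _ _).
have [/hasP[D DR CD]|/hasPn nclose] := boolP (has (fun D => ~~ far G C D) R).
  have [E' [E'a E's E'l]] := pair_cycles CC (RC D DR) CD.
  exists (E' ++ E), (rem D R), p.+1; split.
  - split; first by rewrite all_cat E'a.
    by move=> B /mem_rem; apply: RC.
  - exact: subseq_pairwise (rem_subseq D R) Rfar.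
  - by rewrite size_cat E's Es mulnS.
  - have : 0 < size R by case: (R) DR.
    rewrite /= Ls size_rem //; case: (size R) => // r _.
    by rewrite mulnS /= addnS; lia.
  move=> v; rewrite /load big_cat -/(load E' v) -/(load E v) /=.
  have /permP/(_ (fun C : {set T} => v \in C)) /= cR := perm_to_rem DR.
  rewrite -addnA; apply: leq_trans (leq_add (E'l v) (leqnn _)) _.
  by rewrite -addnA leq_add2l addnCA -cR El.
exists E, (C :: R), p; split=> //.
- by split=> // B; rewrite inE => /orP[/eqP ->|/RC].
- rewrite /= Rfar andbT; apply/allP => D /nclose; by rewrite negbK.
- by rewrite /= Ls addnS.
by move=> v; rewrite /= addnCA leq_add2l.
Qed.

Lemma cover_odd_cycle H (S : {set T}) : is_cycle (2 * n + 1) H ->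
  (forall x y, adj H x y -> (x \in S) || (y \in S)) ->
  n.+1 <= \sum_(v in S) (v \in vset H).
Proof.
move=> /odd_cycle_walk[f W] cS.
have -> : \sum_(v in S) (v \in vset H) = \sum_(v in vset H) (v \in S).
  rewrite big_mkcond [RHS]big_mkcond /=.
  by apply: eq_bigr => v _; do 2!case: ifP.
rewrite (walk_sum m0 W).
have : \sum_(i < 2 * n + 1) 1 <= \sum_(i < 2 * n + 1) ((f i \in S) + (f i.+1 \in S)).
  apply: leq_sum => i _.
  have /orP[] := cS _ _ (walk_adj W i) => ->; first exact: leq_addr.
  exact: leq_addl.
rewrite sum_nat_const card_ord muln1 big_split /=.
have -> : \sum_(i < 2 * n + 1) (f i.+1 \in S) = \sum_(i < 2 * n + 1) (f i \in S).
  rewrite -(walk_sum m0 W (fun v => nat_of_bool (v \in S))).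
  rewrite (walk_sum m0 (walk_shift m0 W 1) (fun v => nat_of_bool (v \in S))).
  by apply: eq_bigr => -[i im] _ /=; rewrite addn1.
by move: (\sum_(i < _) _) => x; lia.
Qed.

Lemma card_odd_cycle H (q : nat) : is_cycle (2 * n + 1) H ->
  \sum_(v in vset H) q = (2 * n + 1) * q.
Proof.
move=> /odd_cycle_walk[f W]; rewrite (walk_sum m0 W (fun=> q)).
by rewrite sum_nat_const card_ord.
Qed.

End OddCycles.

(** * Packings of odd cycles *)

Section PackingNumber.
Variables (R : realType) (T : finType) (n : nat) (G : sgraph T).
Implicit Types (C D : {set T}) (F : {set {set T}}).

Lemma far_gdist C D : far G C D <-> (2%:R%:E <= gdist_sub R G C D)%E.
Proof.
split=> [/farP CD|le2].
  apply: le_ereal_inf_tmp => _ [u [v [uC vD ->]]].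
  apply: le_ereal_inf_tmp => _ [p [puv _ lastp ->]].
  have [uv nuv] := CD u v uC vD.
  rewrite lee_fin ler_nat; case: p puv lastp => [|w [|w' p]] //=.
    by move=> _ e; rewrite e eqxx in uv.
  by rewrite andbT => uw wv; rewrite -wv uw in nuv.
have lt2 u v p : u \in C -> v \in D -> path (adj G) u p -> uniq (u :: p) ->
    last u p = v -> 1 < size p.
  move=> uC vD puv up lastp; rewrite -(ler_nat R) -lee_fin.
  apply: le_trans le2 _; apply: ge_ereal_inf; exists (gdist R G u v).
    by exists u, v.
  by apply: ereal_inf_lbound; exists p.
apply/farP => u v uC vD; split.
  by apply/eqP => uv; have := lt2 u v [::] uC vD isT isT uv.
apply/negP => uv; have := lt2 u v [:: v] uC vD; rewrite /= uv inE (adj_neq uv).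
by move=> /(_ isT isT erefl).
Qed.

Lemma odd_cycle_induced C : odd_cycle_of n G C -> induced_odd_cycle G C.
Proof.
move=> [H [iH cH <-]]; split; first by case: iH.
exists (2 * n + 1); first by rewrite addn1 mul2n /= odd_double.
by rewrite -(induced_is_induced iH) // induced_vset.
Qed.

Lemma pairwise_mem (V : eqType) (r : rel V) (s : seq V) :
  (forall x y, r x y = r y x) -> pairwise r s ->
  forall x y, x \in s -> y \in s -> x != y -> r x y.
Proof.
move=> rC; elim: s => // z s IHs /= /andP[/allP rz rs] x y.
rewrite !inE => /orP[/eqP ->|xs] /orP[/eqP ->|ys]; rewrite ?eqxx //.
- by rewrite rz.
- by rewrite rC rz.
exact: IHs.
Qed.

Lemma odd_cycle_neq0 C : odd_cycle_of n G C -> exists x, x \in C.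
Proof.
by move=> [H [_ /odd_cycle_walk[f W] <-]]; exists (f 0); apply: (walk_vset W).
Qed.

Lemma size_far_le (L : seq {set T}) : (forall C, C \in L -> odd_cycle_of n G C) ->
  pairwise (far G) L -> size L <= packing_number R G.
Proof.
move=> hL farL.
have uL : uniq L.
  rewrite uniq_pairwise.
  apply: (@sub_in_pairwise _ (fun C => C \in L) (far G)) farL; last exact/allP.
  move=> C D CL DL /farP CD; apply: contraTneq CL => CD'.
  apply/negP => /hL/odd_cycle_neq0[x xC].
  by have [] := CD x x xC; rewrite -?CD' // eqxx.
pose F : {set {set T}} := [set C in L].
have <- : #|F| = size L.
  by rewrite cardsE; apply/card_uniqP.
apply: (@leq_bigmax_cond _ (fun F => `[< odd_cycle_packing R G F >])
  (fun F => #|F|)).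
apply/asboolP; split=> [C|C D]; first by rewrite inE => /hL/odd_cycle_induced.
rewrite !inE => CL DL CD; apply/far_gdist.
exact: (pairwise_mem (@farC _ G) farL).
Qed.

Lemma packing_attained :
  exists F, odd_cycle_packing R G F /\ #|F| = packing_number R G.
Proof.
pose P F := `[< odd_cycle_packing R G F >].
have [|F /asboolP pF cF] := @eq_bigmax_cond _ P (fun F => #|F|).
  by apply/card_gt0P; exists set0; apply/asboolP; split=> C; rewrite inE.
by exists F; split=> //; apply/esym.
Qed.

Lemma cycles_perfect (L : seq {set T}) : (forall C, C \in L -> odd_cycle_of n G C) ->
  exists E : seq (T * T), [/\ all (fun e => adj G e.1 e.2) E, size E = n * size L &
    forall v, load E v <= count (fun C : {set T} => v \in C) L].
Proof.
elim: L => [|C L IHL] hL.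
  by exists [::]; split=> // [|v]; rewrite ?muln0 // /load big_nil.
have [|E [Ea Es El]] := IHL.
  by move=> D DL; apply: hL; rewrite inE DL orbT.
have [H [iH cH HC]] := hL C (mem_head _ _).
have [x xC] := odd_cycle_neq0 (hL C (mem_head _ _)).
have [|E' [E'a E's E'l]] := cycle_minus_vertex cH (x := x); first by rewrite HC.
exists (E' ++ E); split.
- by rewrite all_cat Ea (all_adj_induced iH).
- by rewrite size_cat E's Es mulnS.
move=> v; rewrite /load big_cat /=; apply: leq_add; last exact: El.
by apply: leq_trans (E'l v) _; rewrite HC; case: (v \in C); case: (_ != x).
Qed.

(** With p pairs and l leftover cycles the inequality reduces to
    2p + l <= Kp + K, which holds as 2 <= K and l <= K. *)
Lemma near_perfect_matching (a : T -> nat) K :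
  packable G n (odd_cycle_of n G) a -> 2 <= K -> packing_number R G <= K ->
  exists (E : seq (T * T)) (S : {set T}),
    [/\ all (fun e => adj G e.1 e.2) E, (forall v, load E v <= a v), stable G S &
        (K * n + 1) * (weight (vset G) a - weight S a) <= K * n.+1 * (size E + 1)].
Proof.
move=> [E0 [L [E0a LC load_le tight]]] K2 leK.
have [E1 [L' [p [[E1a L'C] L'far E1s Ls E1l]]]] := greedy_pairing LC.
have [E2 [E2a E2s E2l]] := cycles_perfect L'C.
have L'K := leq_trans (size_far_le L'C L'far) leK.
have [S /andP[stS /eqP oS]] := alpha_attained G a.
exists (E0 ++ E1 ++ E2), S; split=> //.
- by rewrite !all_cat E0a E1a E2a.
- move=> v; apply: leq_trans (load_le v); rewrite /load !big_cat /= leq_add2l.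
  exact: leq_trans (leq_add (leqnn _) (E2l v)) (E1l v).
have le_W : weight (vset G) a - weight S a <= size E0 + n.+1 * (2 * p + size L').
  by rewrite oS -Ls leq_subLR addnA.
apply: leq_trans (leq_mul (leqnn _) le_W) _.
rewrite !size_cat E1s E2s.
move: (size E0) (size L') L'K => e l lK {le_W Ls E1s E2s tight oS}.
have h1 : (K * n + 1) * e <= K * n.+1 * e.
  by rewrite leq_mul2r mulnS addnC leq_add2r (leq_trans _ K2) ?orbT.
have h2 : (K * n + 1) * (2 * p + l) <= K * ((2 * n + 1) * p + n * l + 1).
  have : 2 * p <= K * p by rewrite leq_mul2r K2 orbT.
  rewrite !mulnDl !mulnDr !muln1 !mul1n !mulnA; lia.
have h3 : n.+1 * ((K * n + 1) * (2 * p + l)) <=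
    n.+1 * (K * ((2 * n + 1) * p + n * l + 1)).
  by rewrite leq_mul2l h2 orbT.
rewrite mulnDr [_ * (n.+1 * _)]mulnCA; apply: leq_trans (leq_add h1 h3) _.
by rewrite mulnCA mulnA -mulnDr !addnA.
Qed.

Section Blowup.
Variables (F : {set {set T}}) (q : nat).
Hypotheses (Fcyc : forall C, C \in F -> odd_cycle_of n G C)
  (Ffar : forall C D, C \in F -> D \in F -> C != D -> far G C D).

Definition blowup (v : T) : nat := \sum_(C in F) (v \in C) * q.

Lemma blowup_cover (S : {set T}) : cover (adj G) S ->
  #|F| * (q * n.+1) <= weight S blowup.
Proof.
move=> /coverP cS; rewrite /weight /blowup exchange_big /= -sum_nat_const.
apply: leq_sum => C /Fcyc[H [iH cH <-]]; rewrite -big_distrl /= mulnC leq_mul2r.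
apply/orP; right; apply: cover_odd_cycle => // x y xy; apply: cS.
by have [_ ->] := iH; rewrite // (adj_vset xy, adj_vsetr xy).
Qed.

Lemma sum_eq_mem C x : \sum_(v in C) (x == v) = (x \in C).
Proof.
have [xC|xC] := boolP (x \in C).
  by rewrite (bigD1 x) //= eqxx big1 // => v /andP[_ /negbTE vx]; rewrite eq_sym vx.
by rewrite big1 // => v vC; case: eqP vC xC => // -> ->.
Qed.

(** Both ends of an edge of the packing lie on the same cycle, and the cycles are
    disjoint; so each cycle carries at most half of its total weight q(2n+1). *)
Lemma blowup_packs t : packs (adj G) blowup t -> t <= #|F| * (q * (2 * n + 1))./2.
Proof.
move=> [E [<- /allP Ea El]].
have posF v : 0 < blowup v -> exists2 C, C \in F & v \in C.
  rewrite lt0n => /eqP h; apply: contrapT => noC; apply: h.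
  apply: big1 => C CF; case: (boolP (v \in C)) => // vC.
  by case: noC; exists C.
have inF v e : e \in E -> (e.1 == v) || (e.2 == v) ->
    exists2 C, C \in F & v \in C.
  move=> eE ev; apply: posF; apply: leq_trans (El v).
  rewrite /load (big_rem e) //= ltn_addr //.
  by case/orP: ev => ->; rewrite ?addn1.
have nbrC C x y : C \in F -> x \in C -> adj G x y ->
    (exists2 D, D \in F & y \in D) -> y \in C.
  move=> CF xC xy [D DF yD]; have [-> //|CD] := eqVneq C D.
  by have /farP/(_ x y xC yD)[_] := Ffar CF DF CD; rewrite xy.
have same C e : C \in F -> e \in E -> (e.1 \in C) = (e.2 \in C).
  move=> CF eE; have exy := Ea e eE; apply/idP/idP => eC.
    by apply: nbrC CF eC exy _; apply: inF eE _; rewrite eqxx orbT.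
  by apply: nbrC CF eC _ _; [rewrite adjC|apply: inF eE _; rewrite eqxx].
have blowupE C v : C \in F -> v \in C -> blowup v = q.
  move=> CF vC; rewrite /blowup (bigD1 C) //= vC mul1n big1 ?addn0 //.
  move=> D /andP[DF DC].
  case: (boolP (v \in D)) => // vD.
  by have /farP/(_ v v vD vC)[] := Ffar DF CF DC; rewrite eqxx.
have countC C : C \in F -> \sum_(e <- E) (e.1 \in C) <= (q * (2 * n + 1))./2.
  move=> CF; rewrite geq_half_double -mul2n.
  have -> : q * (2 * n + 1) = \sum_(v in C) blowup v.
    have [H [_ cH HC]] := Fcyc CF; rewrite mulnC -(card_odd_cycle q cH) HC.
    by apply: eq_bigr => v vC; rewrite (blowupE C).
  apply: leq_trans (_ : \sum_(v in C) load E v <= _); last first.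
    by apply: leq_sum => v _; apply: El.
  rewrite exchange_big big_distrr /= big_seq [leqRHS]big_seq.
  apply: leq_sum => e eE; rewrite big_split /= !sum_eq_mem -same // mul2n addnn.
  by [].
apply: leq_trans (_ : \sum_(C in F) \sum_(e <- E) (e.1 \in C) <= _); last first.
  by rewrite -sum_nat_const; apply: leq_sum => C; apply: countC.
rewrite exchange_big /= -sum1_size big_seq [leqRHS]big_seq.
apply: leq_sum => e eE; have [|C CF eC] := inF e.1 e eE; first by rewrite eqxx.
by rewrite (bigD1 C) //= eC.
Qed.

End Blowup.
End PackingNumber.

(** * From weights on the vertices to the resurgence *)

Section EdgeIdeals.
Variables (R : realType) (K : fieldType) (T : finType) (G : sgraph T).

Definition index_adj : rel 'I_#|vset G| :=
  fun i j => adj G (enum_val i) (enum_val j).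

Lemma edge_idealE : edge_ideal K G = @rel_ideal K #|vset G| index_adj.
Proof. by []. Qed.

Lemma index_adjxx : irreflexive index_adj.
Proof. by move=> i; apply: adjxx. Qed.

Lemma index_adjC i j : index_adj i j = index_adj j i.
Proof. exact: adjC. Qed.

Lemma vset_index x : x \in vset G -> exists i : 'I_#|vset G|, x = enum_val i.
Proof. by move=> xG; exists (enum_rank_in xG x); rewrite enum_rankK_in. Qed.

Lemma load_index (s : seq ('I_#|vset G| * 'I_#|vset G|)) i :
  load [seq (enum_val e.1, enum_val e.2) | e <- s] (enum_val i) = load s i.
Proof.
rewrite /load big_map; apply: eq_bigr => e _ /=.
by rewrite !(inj_eq enum_val_inj).
Qed.

Lemma packs_index (a : T -> nat) t :
  packs index_adj (fun i => a (enum_val i)) t <-> packs (adj G) a t.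
Proof.
split=> [[s [<- sr sa]]|[E [<- Ea El]]].
  exists [seq (enum_val e.1, enum_val e.2) | e <- s]; split.
  - by rewrite size_map.
  - by rewrite all_map.
  move=> v; have [/vset_index[i ->]|vG] := boolP (v \in vset G).
    by rewrite load_index.
  rewrite /load big_map big1 // => e _ /=.
  by rewrite !(negbTE (contraNneq _ vG)) // => <-; apply: enum_valP.
have [s sE] : exists s : seq ('I_#|vset G| * 'I_#|vset G|),
    E = [seq (enum_val e.1, enum_val e.2) | e <- s].
  elim: E Ea {El} => [|[x y] E IHE] /=; first by exists [::].
  case/andP => xy /IHE[s ->].
  have [i ->] := vset_index (adj_vset xy).
  by have [j ->] := vset_index (adj_vsetr xy); exists ((i, j) :: s).
exists s; split; first by rewrite sE size_map.
  by move: Ea; rewrite sE all_map.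
by move=> i; rewrite -load_index -sE.
Qed.

Lemma cover_index (C : {set 'I_#|vset G|}) (a : T -> nat) : cover index_adj C ->
  cover (adj G) [set enum_val i | i in C] /\
  weight [set enum_val i | i in C] a = weight C (fun i => a (enum_val i)).
Proof.
move=> /coverP cC; split; last by apply: big_imset => i j _ _; apply: enum_val_inj.
apply/coverP => x y xy; have [i xE] := vset_index (adj_vset xy).
have [j yE] := vset_index (adj_vsetr xy).
have /orP[iC|jC] : (i \in C) || (j \in C).
  by apply: cC; rewrite /index_adj -xE -yE.
  by rewrite xE imset_f.
by rewrite yE imset_f // orbT.
Qed.

Lemma cover_of_stable (S : {set T}) (a : T -> nat) : stable G S ->
  cover index_adj [set i : 'I_#|vset G| | enum_val i \notin S] /\
  weight [set i : 'I_#|vset G| | enum_val i \notin S] (fun i => a (enum_val i))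
    = weight (vset G) a - weight S a.
Proof.
move=> /stableP[sS hS]; split.
  apply/coverP => i j; rewrite !inE -negb_and; apply: contraL => /andP[iS jS].
  exact: hS.
rewrite {2}/weight (big_setID S) /= (setIidPr sS) addKn.
rewrite /weight (eq_bigl (fun i : 'I_#|vset G| => enum_val i \notin S)).
  rewrite -(big_enum_val_cond (fun v => v \notin S) a) /=.
  by apply: eq_bigl => v; rewrite !inE andbC.
by move=> i; rewrite inE.
Qed.

Lemma resurgence_le (p q : nat) : 0 < q ->
  (forall a : T -> nat, exists (E : seq (T * T)) (S : {set T}),
    [/\ all (fun e => adj G e.1 e.2) E, (forall v, load E v <= a v), stable G S &
        q * (weight (vset G) a - weight S a) <= p * (size E + 1)]) ->
  (resurgence R (edge_ideal K G) <= (p%:R / q%:R)%:E)%E.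
Proof.
move=> q0 hmatch; apply: ge_ereal_sup => _ [d [t [d0 t0 nsub ->]]].
rewrite lee_fin leNgt; apply/negP => lt_pq; apply: nsub; rewrite edge_idealE.
have lt_pt : p * t < d * q.
  rewrite -(ltr_nat R) !natrM; move: lt_pq.
  by rewrite ltr_pdivrMr ?ltr0n // mulrAC ltr_pdivlMr ?ltr0n.
apply: symbolic_pow_sub_pow; [exact: index_adjxx|exact: index_adjC|] => a hd.
pose b (v : T) := \sum_(i : 'I_#|vset G| | enum_val i == v) a i.
have bE i : b (enum_val i) = a i.
  rewrite /b (eq_bigl (pred1 i)) ?big_pred1_eq // => j.
  by rewrite (inj_eq enum_val_inj).
have [E [S [Ea El stS leE]]] := hmatch b.
have [cS wS] := cover_of_stable b stS.
have le_d : d <= weight (vset G) b - weight S b.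
  rewrite -wS; apply: leq_trans (hd _ cS) _.
  by apply: leq_sum => i _; rewrite bE.
have le_t : t <= size E.
  have lt_pE : p * t < p * (size E + 1).
    apply: leq_trans lt_pt _; apply: leq_trans leE.
    by rewrite mulnC leq_mul2l le_d orbT.
  by move: lt_pE; rewrite ltn_mul2l addn1 ltnS => /andP[].
have : packs (adj G) b (size E) by exists E.
move=> /packs_index/(packs_leq le_t)[s [st sr sl]]; exists s; split=> // i.
by rewrite -bE.
Qed.

Lemma le_resurgence n (F : {set {set T}}) q :
  (forall C, C \in F -> odd_cycle_of n G C) ->
  (forall C D, C \in F -> D \in F -> C != D -> far G C D) ->
  0 < #|F| * (q * n.+1) ->
  (((#|F| * (q * n.+1))%:R / (#|F| * (q * (2 * n + 1))./2 + 1)%:R)%:E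
    <= resurgence R (edge_ideal K G))%E.
Proof.
move=> Fcyc Ffar pos; apply: ereal_sup_ubound.
exists (#|F| * (q * n.+1)), (#|F| * (q * (2 * n + 1))./2 + 1); split=> //.
  by rewrite addn1.
pose m := mpoly.Multinom [tuple blowup F q (enum_val i) | i < #|vset G|].
have mE i : mpoly.fun_of_multinom m i = blowup F q (enum_val i).
  by rewrite mpoly.multinomE tnth_mktuple.
rewrite edge_idealE; apply: (symbolic_pow_not_sub index_adjxx index_adjC (m := m)).
- move=> C /(cover_index (blowup F q))[cC wC].
  rewrite (_ : weight C _ = weight C (fun i => blowup F q (enum_val i))).
    by rewrite -wC; apply: (blowup_cover q Fcyc cC).
  by apply: eq_bigr => i _; apply: mE.
move=> [s [st sr sl]].
have /packs_index/(blowup_packs Fcyc Ffar) :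
    packs index_adj (fun i => blowup F q (enum_val i))
      (#|F| * (q * (2 * n + 1))./2 + 1).
  by exists s; split=> // i; rewrite -mE.
by rewrite addn1 ltnn.
Qed.

End EdgeIdeals.

(** * The resurgence of a clique-sum *)

Section Pieces.
Variables (T : finType) (n : nat).

Lemma packable_pieces (Cyc : {set T} -> Prop) s (G : sgraph T) : clique_sum_of s G ->
  (forall H, H \in s -> forall a, packable H n Cyc a) ->
  forall a, packable G n Cyc a.
Proof.
elim=> [G' h|s1 s2 G1 G2 G' _ IH1 _ IH2 sumG h] a; first by apply: h; rewrite inE.
apply: (packable_clique_sum sumG); [apply: IH1|apply: IH2] => H Hs.
  by apply: h; rewrite mem_cat Hs.
by apply: h; rewrite mem_cat Hs orbT.
Qed.

Lemma induced_odd_cycle_of_pieces s (G : sgraph T) : clique_sum_of s G ->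
  (forall H, H \in s -> bipartite H \/ is_cycle (2 * n + 1) H) ->
  forall C, induced_odd_cycle G C -> odd_cycle_of n G C.
Proof.
move=> sumG hs C [sC [m om cC]].
have [H [Hs sH cH]] := induced_cycle_in_piece sumG sC cC.
case: (hs H Hs) => [bH|cycH].
  by have := bipartite_no_odd_cycle bH sH cH; rewrite om.
exists H; split=> //; first exact: piece_is_induced sumG H Hs.
by rewrite (induced_cycle_of_cycle cycH sH cH).
Qed.

End Pieces.

Local Open Scope ring_scope.

(** The ratios on the left increase to (2n+2)/(2n+1) without reaching it. *)
Lemma limit_ratio_le (R : realType) (n : nat) (x : \bar R) :
  (forall j, (((2 * j + 1) * n.+1)%:R / (j * (2 * n + 1) + n.+1)%:R)%:E <= x)%E ->
  (((2 * n + 2)%:R / (2 * n + 1)%:R)%:E <= x)%E.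
Proof.
case: x => [x h| _|/(_ 0%N)]; last by rewrite leeNy_eq.
  rewrite lee_fin ler_pdivrMr ?ltr0n ?addn1 // leNgt -addn1; apply/negP => lt_x.
  (* Cross-multiplied, the bound for j says j e + (n+1) <= x (n+1). *)
  pose e := (2 * n + 2)%:R - x * (2 * n + 1)%:R.
  have e0 : 0 < e by rewrite subr_gt0.
  pose y := x * n.+1%:R / e.
  have := archi_boundP (normr_ge0 y); set j := Num.bound _ => lt_yj.
  have {lt_yj} : x * n.+1%:R < j%:R * e.
    by rewrite -ltr_pdivrMr // (le_lt_trans _ lt_yj) // ler_norm.
  have := h j; rewrite lee_fin ler_pdivrMr; last by rewrite ltr0n addnS.
  rewrite /e -[n.+1]addn1 !(natrD, natrM).
  have : (0 : R) <= n%:R by rewrite ler0n.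
  move: (n%:R) (j%:R) => n' j'; nra.
by rewrite leey.
Qed.

Theorem theorem5p9 (R : realType) (K : fieldType) (T : finType) (n : nat)
    (G : sgraph T) (pieces : seq (sgraph T)) :
  (1 <= n)%N ->
  clique_sum_of pieces G ->
  (forall H : sgraph T, H \in pieces -> no_isolated H) ->
  (forall H : sgraph T, H \in pieces -> bipartite H \/ is_cycle (2 * n + 1) H) ->
  (exists2 H : sgraph T, H \in pieces & is_cycle (2 * n + 1) H) ->
  let k := packing_number R G in
  resurgence R (edge_ideal K G) =
    (if k == 1%N then (2 * n + 2)%:R / (2 * n + 1)%:R
     else (k * n + k)%:R / (k * n + 1)%:R)%:E.
Proof.
move=> n0 sumG _ hs [H Hs cH] k.
have cycH : odd_cycle_of n G (vset H).
  by exists H; split=> //; apply: piece_is_induced sumG H Hs.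
have pack a : packable G n (odd_cycle_of n G) a.
  apply: (packable_pieces sumG) => H' Hs' b.
  have [bH|cH'] := hs H' Hs'; first exact: packable_bipartite.
  apply: packable_cycle => //.
  by exists H'; split=> //; apply: piece_is_induced sumG H' Hs'.
have k0 : (0 < k)%N.
  apply: (@size_far_le R _ n G [:: vset H]) => //.
  by move=> C; rewrite inE => /eqP ->.
have [F [[Find Fdist] cF]] := packing_attained R G.
have Fcyc C : C \in F -> odd_cycle_of n G C.
  by move=> /Find; apply: induced_odd_cycle_of_pieces sumG hs C.
have Ffar C D : C \in F -> D \in F -> C != D -> far G C D.
  by move=> CF DF CD; apply/(far_gdist R)/Fdist.
(* K' is 2 if k = 1, and k otherwise. *)
have upper K' : (2 <= K')%N -> (k <= K')%N ->
    (resurgence R (edge_ideal K G) <= ((K' * n.+1)%:R / (K' * n + 1)%:R)%:E)%E.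
  move=> K2 kK; apply: resurgence_le; first by rewrite addn1.
  by move=> a; apply: near_perfect_matching (pack a) K2 kK.
have lower q := le_resurgence R K (q := q) Fcyc Ffar.
apply/eqP; rewrite eq_le; case: eqP => [k1|/eqP k1].
  apply/andP; split.
    apply: le_trans (upper 2 isT _) _; first by rewrite k1.
    by rewrite mulnS addnC.
  apply: limit_ratio_le => j.
  have odd_half : (((2 * j + 1) * (2 * n + 1))./2 = j * (2 * n + 1) + n)%N.
    rewrite mulnDl mul1n addnA -mulnA mul2n [(2 * n)%N]mul2n -doubleD addn1.
    by rewrite /= uphalf_double.
  have := lower (2 * j + 1)%N; rewrite cF -/k k1 !mul1n odd_half.
  rewrite -[(_ + n + 1)%N]addnA [(n + 1)%N]addn1; apply.
  by rewrite muln_gt0 addn1.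
have k2 : (2 <= k)%N by rewrite ltn_neqAle eq_sym k1.
apply/andP; split.
  by apply: le_trans (upper k k2 (leqnn _)) _; rewrite mulnS addnC.
have half : ((2 * n + 1)./2 = n)%N by rewrite addn1 mul2n /= uphalf_double.
have := lower 1%N; rewrite cF -/k !mul1n half mulnS addnC; apply.
by rewrite addn_gt0 k0 orbT.
Qed.
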